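(* Let $p$ be an odd prime number and let $1<e_1,e_2,e_3<p$ be integers such that $E:=e_1+e_2+e_3$ is even and $e_3\neq p-1$. Put $d=(E+p-3)/2$, i.e. $\boldsymbol{C}:=(d;e_1,e_2,e_3,p-1)$ is a genus-$0$ ramification type. Let $h_p^0(\boldsymbol{C})$ denote the $p$-Hurwitz number of $\boldsymbol{C}$. (a) The number $h_p^0(\boldsymbol{C})$ is positive if and only if $$p+1\leq E\leq p-1+2\min_{i\in\{1,2,3\}} e_i .$$ (b) If the equivalent conditions of (a) are satisfied, then $$h_p^0(\boldsymbol{C})=\frac{1}{2}(3p-1-E).$$
   Context: Let $k$ be an algebraically closed field of characteristic $p>0$. A cover is a finite separable, tamely ramified morphism $f:X\to\mathbb{P}^1_k$ with $X$ a smooth projective connected curve. Branch points are ordered and normalized: $\boldsymbol{x}=(x_1=0,x_2=1,x_3=\infty,x_4=\lambda)$ with $\lambda\in\mathbb{P}^1_k\setminus\{0,1,\infty\}$. For integers $e_i>1$, a cover has (single-cycle) ramification type $(d;e_1,e_2,e_3,e_4)$ if it has degree $d$, is branched exactly at the four branch points, and for each $i$ the fiber over $x_i$ contains exactly one ramified point, whose ramification index is $e_i$. The type has genus $0$ if $\sum_i(e_i-1)=2d-2$; then by Riemann--Hurwitz $X$ has genus $0$, so covers of this type are maps $\mathbb{P}^1_k\to\mathbb{P}^1_k$. Two covers $f_1:X_1\to\mathbb{P}^1$, $f_2:X_2\to\mathbb{P}^1$ are isomorphic if there is an isomorphism $\iota:X_1\to X_2$ with $f_2\circ\iota=f_1$.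 The $p$-Hurwitz number $h_p(d;e_1,\dots,e_4)$, written $h_p^0(\cdot)$ when the type has genus $0$, is the number of isomorphism classes of covers of the given ramification type whose branch locus $(0,1,\infty,\lambda)$ is generic (corresponds to the generic point of the $\lambda$-line); equivalently, it is the maximum over $\lambda$ of the number of isomorphism classes of covers of the given type with branch locus $(0,1,\infty,\lambda)$. It does not depend on $k$. It is $0$ if no such cover exists (for example if some ramification index exceeds $d$). *)

(* Defs.v *)
From HB Require Import structures.
From mathcomp Require Import all_boot all_order all_algebra all_field.
From mathcomp Require Import boolp classical_sets functions cardinality.

Set Implicit Arguments.
Unset Strict Implicit.
Unset Printing Implicit Defensive.

Import GRing.Theory.
Local Open Scope ring_scope.

(* P^1(k), with [None] the point at infinity. *)
Definition P1 (k : Type) := option k.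

(* Morphisms P^1 -> P^1, as fractions num / den in lowest terms; [den = 0]
   gives the constant map with value infinity. *)
Record P1map (k : fieldType) := MkP1map {
  num : {poly k};
  den : {poly k};
  num_den_coprime : coprimep num den
}.

Section P1Maps.
Variable k : fieldType.
Implicit Types (f : P1map k) (x y : P1 k).

Definition degree f : nat := (maxn (size (num f)) (size (den f))).-1.

(* At infinity, evaluate the homogenizations of [num] and [den] in degree
   [degree f] at [1 : 0]. *)
Definition P1app f y : P1 k :=
  let: (u, v) := if y is Some b then ((num f).[b], (den f).[b])
                 else ((num f)`_(degree f), (den f)`_(degree f)) in
  if v == 0 then None else Some (u / v).

(* The fibre over x is the zero locus of this polynomial, seen as a form of
   degree [degree f]. *)
Definition fiber_poly f x : {poly k} :=
  if x is Some a then num f - a *: den f else den f.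

(* Order of vanishing at y of the pullback of a local parameter at [f y]. At
   y = oo it is the vanishing order at oo of a form of degree [degree f]. *)
Definition ram_index f y : nat :=
  let F := fiber_poly f (P1app f y) in
  if y is Some b then mup b F else (degree f - (size F).-1)%N.

Definition ramified f y : Prop := (1 < ram_index f y)%N.

(* k(z) is generated over k(t), t = num / den, by z, whose minimal polynomial
   is num - t den up to a scalar. *)
Definition separable_map f : Prop :=
  let c (a : k) : {fraction {poly k}} := tofrac a%:P in
  separable_poly (map_poly c (num f) - tofrac 'X *: map_poly c (den f)).

Definition tame f : Prop :=
  forall p, p \in [pchar k] -> forall y, ~~ (p %| ram_index f y)%N.

Definition is_cover f : Prop :=
  [/\ (0 < degree f)%N, separable_map f & tame f].

Definition P1iso (i : P1map k) : Prop :=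
  exists j : P1map k, cancel (P1app i) (P1app j) /\ cancel (P1app j) (P1app i).

(* Equality is tested on k-points, which determine a morphism when k is
   infinite. *)
Definition isomorphic f1 f2 : Prop :=
  exists2 i, P1iso i & forall y, P1app f2 (P1app i y) = P1app f1 y.

Definition branch_points (lam : k) : 4.-tuple (P1 k) :=
  [tuple Some 0; Some 1; None; Some lam].

Definition has_ramification_type (lam : k) (d : nat) (e : 4.-tuple nat) f :=
  [/\ is_cover f,
      degree f = d,
      forall x, (exists2 y, P1app f y = x & ramified f y) <->
                x \in (branch_points lam : seq (P1 k))
    & forall i : 'I_4, exists2 y,
        unique (fun y => P1app f y = tnth (branch_points lam) i /\
                         ramified f y) y
        & ram_index f y = tnth e i].

Local Open Scope classical_set_scope.
Local Open Scope card_scope.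

Definition cover_classes (lam : k) (d : nat) (e : 4.-tuple nat)
    : set (set (P1map k)) :=
  [set [set g | has_ramification_type lam d e g /\ isomorphic f g]
     | f in [set f | has_ramification_type lam d e f]].

End P1Maps.

Local Open Scope classical_set_scope.
Local Open Scope card_scope.

(* [h] is the p-Hurwitz number of the genus-0 type (d; e), with p the
   characteristic of k: the maximum over lambda of the number of isomorphism
   classes. In genus 0 the source of a cover is P^1. *)
Definition is_pHurwitz0 (k : fieldType) (d : nat) (e : 4.-tuple nat)
    (h : nat) : Prop :=
  [/\ (\sum_(i < 4) (tnth e i).-1 = d.*2 - 2)%N,
      exists lam : k, [/\ lam != 0, lam != 1 & cover_classes lam d e #= `I_h]
    & forall lam : k, lam != 0 -> lam != 1 -> cover_classes lam d e #<= `I_h].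

Lemma is_pHurwitz0_unique (k : fieldType) (d : nat) (e : 4.-tuple nat) h h' :
  is_pHurwitz0 k d e h -> is_pHurwitz0 k d e h' -> h = h'.
Proof.
have le m n : is_pHurwitz0 k d e m -> is_pHurwitz0 k d e n -> (m <= n)%N.
  case=> _ [lam [l0 l1 E]] _ [_ _ /(_ lam l0 l1)].
  by rewrite (card_le_eql E) card_le_II.
by move=> H H'; apply/eqP; rewrite eqn_leq !le.
Qed.

(* Main.v *)
Require Import Defs.
From mathcomp Require Import all_boot all_order all_algebra all_field.
From mathcomp Require Import ring zify.
From mathcomp Require Import classical_sets cardinality.

Set Implicit Arguments.
Unset Strict Implicit.
Unset Printing Implicit Defensive.

Import GRing.Theory.
Local Open Scope ring_scope.

(** The ramified points can be moved to 0, 1, infinity and [mu], so that what is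
   to be counted, for given [lam], is the set of pairs [(mu, f)] in which [f] has
   degree [d], fixes 0, 1 and infinity with ramification indices [e1], [e2], [e3],
   and takes the value [lam] at [mu] with index [p - 1].

   The index [p - 1] is special: as [f - lam] vanishes to order [p - 1] at [mu],
   the function [g = (z - mu) ^ p / (f - lam)] is unramified there. The factor
   [(z - mu) ^ p] being a [p]-th power, [g] is still ramified with indices [e1] and
   [e2] at 0 and 1, and with index [p - e3] at infinity. Up to an affine change of
   coordinate, [g] is therefore a cover branched over at most three points. In
   terms of numerators and denominators, [g = P / U], where [U] has degree [m = d - p + 1], [P] has degree
   [n = d - e3 + 1], [m + n + 1 = e1 + e2], [P] vanishes to order [e1] at 0 and
   [U - P] to order [e2] at 1. This is a Padé problem ([pade]): it has a nonzero
   solution because it has one more unknown than equations ([pade_exists]), the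
   solution is unique up to a scalar because [U1 * P - P1 * U] has too many zeros
   ([pade_unique]), and it is a genuine cover as soon as [e1, e2 <= n < p]
   ([exact_pade_exists]): its Wronskian has degree at most
   [m + n - 1 = (e1 - 1) + (e2 - 1)], hence is a scalar multiple of
   [X ^ (e1 - 1) * (X - 1) ^ (e2 - 1)], and it is not 0 because degrees are less than [p]. Conversely [n < p] is forced,
   since [X ^ p * U - P] vanishes to orders [e1] and [e2] at 0 and 1
   ([cover_pade]). The inequalities [0 <= m], [e1 <= n], [e2 <= n] and [n < p]
   together amount to the condition of the theorem.

   Given [g], normalized by [g 0 = 0] and [g 1 = 1], one recovers
   [f = lam + a * (z ^ p - mu ^ p) / (g - g mu)]. The requirement that [f] fix 0
   and 1 determines [a] and amounts to
   [lam = mu ^ p * (1 - g mu) / (mu ^ p - g mu)], that is, to the vanishing at [mu]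
   of [lam_poly]. Once the zeros at 0 and 1 are discarded, this equation has degree
   [p - 1 - m = (3 p - 1 - E) / 2], and all its roots are simple, because the
   right-hand side has derivative
   [mu ^ p * (1 - mu ^ p) * g' mu / (mu ^ p - g mu) ^ 2] ([lam_poly_roots]). A root
   is acceptable unless [mu] is a pole of [g], in which case [lam = mu ^ p]; this excludes only finitely many [lam], so the
   bound [p - 1 - m] on the number of covers ([card_cover_classes_le]) is attained
   ([card_cover_classes]). *)

(** * Binary forms *)

Section Forms.
Variable k : fieldType.
Implicit Types (F G P Q : {poly k}) (a b c u v : k).

(** The form of degree [n] whose dehomogenization is [F], at [(u, v)]. *)
Definition hval (n : nat) F u v : k :=
  \sum_(i < n.+1) F`_i * (u ^+ i * v ^+ (n - i)).

(** The same form at a pair of polynomials. *)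
Definition hpoly (n : nat) F P Q : {poly k} :=
  \sum_(i < n.+1) F`_i *: (P ^+ i * Q ^+ (n - i)).

Lemma hval_neq0 n F u v :
  (size F <= n.+1)%N -> v != 0 -> hval n F u v = v ^+ n * F.[u / v].
Proof.
move=> sF v0; rewrite /hval (horner_coef_wide _ sF) mulr_sumr.
apply: eq_bigr => i _; have le_in : (i <= n)%N by rewrite -ltnS.
rewrite [RHS]mulrCA; congr (_ * _); rewrite expr_div_n mulrCA; congr (_ * _).
by rewrite -[in v ^+ n](subnK le_in) exprD mulfK // expf_neq0.
Qed.

Lemma hval_v0 n F u : hval n F u 0 = F`_n * u ^+ n.
Proof.
rewrite /hval big_ord_recr /= subnn mulr1 big1 ?add0r // => i _.
by rewrite expr0n subn_eq0 leqNgt ltn_ord !mulr0.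
Qed.

Lemma hvalZ n c F u v : hval n (c *: F) u v = c * hval n F u v.
Proof. by rewrite /hval mulr_sumr; apply: eq_bigr => i _; rewrite coefZ -mulrA. Qed.

Lemma horner_hpoly n F P Q a : (hpoly n F P Q).[a] = hval n F P.[a] Q.[a].
Proof.
rewrite /hpoly horner_sum; apply: eq_bigr => i _.
by rewrite hornerZ hornerM !horner_exp.
Qed.

Lemma size_exp_bound P m i : (size P <= m.+1)%N -> (size (P ^+ i) <= (m * i).+1)%N.
Proof.
move=> sP; elim: i => [|i IH]; first by rewrite expr0 size_poly1.
rewrite exprS; apply: leq_trans (size_polyMleq _ _) _.
rewrite mulnS; lia.
Qed.

Lemma coefM_top F G (s t : nat) : (size F <= s.+1)%N -> (size G <= t.+1)%N ->
  (F * G)`_(s + t) = F`_s * G`_t.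
Proof.
move=> sF sG; rewrite coefM.
have lts : (s < (s + t).+1)%N by rewrite ltnS leq_addr.
rewrite (bigD1 (Ordinal lts)) //= addKn big1 ?addr0 // => j.
rewrite -val_eqE /= neq_ltn => /orP[ltj|ltj].
  by rewrite [X in _ * X]nth_default ?mulr0 //; apply: leq_trans sG _; lia.
by rewrite [X in X * _]nth_default ?mul0r //; apply: leq_trans ltj.
Qed.

Lemma coef_exp_top P m i : (size P <= m.+1)%N -> (P ^+ i)`_(m * i) = P`_m ^+ i.
Proof.
move=> sP; elim: i => [|i IH]; first by rewrite muln0 !expr0 coef1.
by rewrite !exprS mulnS coefM_top ?IH // size_exp_bound.
Qed.

Lemma size_hpoly n m F P Q : (size P <= m.+1)%N -> (size Q <= m.+1)%N ->
  (size (hpoly n F P Q) <= (n * m).+1)%N.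
Proof.
move=> sP sQ; apply: leq_trans (size_sum _ _ _) _; apply/bigmax_leqP => i _.
apply: leq_trans (size_scale_leq _ _) _; apply: leq_trans (size_polyMleq _ _) _.
have le_in : (i <= n)%N by rewrite -ltnS.
have := size_exp_bound i sP; have := size_exp_bound (n - i) sQ.
have -> : (n * m = m * (n - i) + m * i)%N by rewrite -mulnDr subnK // mulnC.
lia.
Qed.

(** The top coefficient is the value at infinity of a form. *)
Lemma coef_hpoly_top n m F P Q : (size P <= m.+1)%N -> (size Q <= m.+1)%N ->
  (hpoly n F P Q)`_(n * m) = hval n F P`_m Q`_m.
Proof.
move=> sP sQ; rewrite coef_sum; apply: eq_bigr => i _; rewrite coefZ.
have le_in : (i <= n)%N by rewrite -ltnS.
have -> : (n * m = m * i + m * (n - i))%N by rewrite -mulnDr subnKC // mulnC.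
by rewrite coefM_top ?size_exp_bound // !coef_exp_top.
Qed.

Lemma hpolyZ n c F P Q : hpoly n (c *: F) P Q = c *: hpoly n F P Q.
Proof.
by rewrite scaler_sumr; apply: eq_bigr => i _; rewrite coefZ scalerA.
Qed.

Lemma hpolyB n F G P Q : hpoly n (F - G) P Q = hpoly n F P Q - hpoly n G P Q.
Proof. by rewrite -sumrB; apply: eq_bigr => i _; rewrite coefB scalerBl. Qed.

Lemma hpoly_widen n F P Q :
  (size F <= n.+1)%N -> hpoly n.+1 F P Q = Q * hpoly n F P Q.
Proof.
move=> sF; rewrite /hpoly big_ord_recr /= nth_default // scale0r addr0 mulr_sumr.
apply: eq_bigr => i _; rewrite -scalerAr; congr (_ *: _).
by rewrite subSn -1?ltnS // exprS mulrCA.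
Qed.

Lemma hpolyMX n F P Q : hpoly n.+1 (F * 'X) P Q = P * hpoly n F P Q.
Proof.
rewrite /hpoly big_ord_recl /= coefMX eqxx scale0r add0r mulr_sumr.
apply: eq_bigr => i _; rewrite -scalerAr coefMX /=; congr (_ *: _).
by rewrite /bump /= add1n subSS exprS mulrA.
Qed.

Lemma hpolyMXsubC n F b P Q : (size F <= n.+1)%N ->
  hpoly n.+1 (('X - b%:P) * F) P Q = (P - b *: Q) * hpoly n F P Q.
Proof.
move=> sF; rewrite mulrBl mulrC mul_polyC hpolyB hpolyMX hpolyZ hpoly_widen //.
by rewrite mulrBl scalerAl.
Qed.

(** Substitution respects the order of vanishing at a finite point... *)
Lemma hpoly_expXsubC n e F b P Q : (size F <= n.+1)%N ->
  hpoly (e + n) (('X - b%:P) ^+ e * F) P Q = (P - b *: Q) ^+ e * hpoly n F P Q.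
Proof.
move=> sF; elim: e => [|e IH]; first by rewrite !expr0 !mul1r.
rewrite addSn exprS -mulrA hpolyMXsubC ?IH 1?exprS ?mulrA //.
apply: leq_trans (size_polyMleq _ _) _; rewrite size_exp_XsubC; lia.
Qed.

(** ... and at infinity. *)
Lemma hpoly_exp_widen n e F P Q : (size F <= n.+1)%N ->
  hpoly (e + n) F P Q = Q ^+ e * hpoly n F P Q.
Proof.
move=> sF; elim: e => [|e IH]; first by rewrite expr0 mul1r.
by rewrite addSn hpoly_widen ?IH 1?exprS ?mulrA //; apply: leq_trans sF _; lia.
Qed.

End Forms.

(** * Morphisms of the projective line *)

Section ClosedPoly.
Variable k : closedFieldType.
Implicit Types (q F : {poly k}).

Lemma exists_nonroot q : q != 0 -> exists x, q.[x] != 0.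
Proof.
move=> q0; have sXq : size ('X * q + 1%:P) != 1%N.
  rewrite mulrC size_polyDl size_mulX // ?eqSS ?size_poly_eq0 //.
  by rewrite size_poly1 ltnS lt0n size_poly_eq0.
have /closed_rootP[x /rootP] := sXq.
rewrite hornerD hornerM hornerX hornerC => Hx; exists x.
by apply: contra_eq_neq Hx => ->; rewrite mulr0 add0r oner_neq0.
Qed.

Lemma poly_eq0_horner q : (forall x, q.[x] = 0) -> q = 0.
Proof.
move=> q0; apply/eqP; apply: contraT => /exists_nonroot[x].
by rewrite q0 eqxx.
Qed.

End ClosedPoly.

Section P1MapTheory.
Variable k : closedFieldType.
Implicit Types (f g i : P1map k) (x y : P1 k) (u v a b c : k).

(** The point with homogeneous coordinates [u : v], and conversely. *)
Definition pt u v : P1 k := if v == 0 then None else Some (u / v).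
Definition rep y : k * k := if y is Some b then (b, 1) else (1, 0).

Lemma pt_rep y : pt (rep y).1 (rep y).2 = y.
Proof. by case: y => [b|]; rewrite /pt /= ?oner_eq0 ?divr1 ?eqxx. Qed.

Lemma rep_neq0 y : ((rep y).1 != 0) || ((rep y).2 != 0).
Proof. by case: y => [b|] /=; rewrite oner_neq0 ?orbT. Qed.

Lemma ptZ c u v : c != 0 -> pt (c * u) (c * v) = pt u v.
Proof.
move=> c0; rewrite /pt mulf_eq0 (negPf c0) /=; case: eqP => // _.
by rewrite -mulf_div divff // mul1r.
Qed.

Lemma pt_eq u v b : ((u != 0) || (v != 0)) -> pt u v = Some b <-> u - b * v = 0.
Proof.
rewrite /pt; case: (eqVneq v 0) => [->|v0].
  by rewrite orbF mulr0 subr0 => /eqP u0; split.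
move=> _; split=> [[<-]|/eqP]; first by rewrite divfK // subrr.
by rewrite subr_eq0 => /eqP->; rewrite mulfK.
Qed.

Lemma pt_eqoo u v : pt u v = None <-> v = 0.
Proof. by rewrite /pt; case: eqP. Qed.

Lemma size_num f : (size (num f) <= (degree f).+1)%N.
Proof. by rewrite /degree; have := leq_maxl (size (num f)) (size (den f)); lia. Qed.

Lemma size_den f : (size (den f) <= (degree f).+1)%N.
Proof. by rewrite /degree; have := leq_maxr (size (num f)) (size (den f)); lia. Qed.

Hint Resolve size_num size_den : core.

Lemma P1appE f y :
  P1app f y = pt (hval (degree f) (num f) (rep y).1 (rep y).2)
                 (hval (degree f) (den f) (rep y).1 (rep y).2).
Proof.
case: y => [b|] /=; last by rewrite !hval_v0 !expr1n !mulr1.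
by rewrite !hval_neq0 ?oner_neq0 // !expr1n !mul1r divr1.
Qed.

Lemma degree_eq f : maxn (size (num f)) (size (den f)) = (degree f).+1.
Proof.
rewrite /degree prednK // leq_max !lt0n !size_poly_eq0.
rewrite -negb_and; apply/negP => /andP[/eqP n0 /eqP d0].
by have := num_den_coprime f; rewrite n0 d0 coprimep0 -size_poly_eq1 size_poly0.
Qed.

Lemma top_coef_neq0 f :
  ((num f)`_(degree f) != 0) || ((den f)`_(degree f) != 0).
Proof.
have := degree_eq f; case: leqP => _ E.
  by apply/orP; right; rewrite -[degree f]/(degree f).+1.-1 -E -/(lead_coef _)
    lead_coef_eq0 -size_poly_eq0 E.
by apply/orP; left; rewrite -[degree f]/(degree f).+1.-1 -E -/(lead_coef _)
    lead_coef_eq0 -size_poly_eq0 E.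
Qed.

(** Numerator and denominator, as forms, have no common zero. *)
Lemma hval_num_den_neq0 f u v : (u != 0) || (v != 0) ->
  (hval (degree f) (num f) u v != 0) || (hval (degree f) (den f) u v != 0).
Proof.
case: (eqVneq v 0) => [->|v0 _].
  rewrite orbF => u0; rewrite !hval_v0 !mulf_eq0 !(negPf (expf_neq0 _ u0)) !orbF.
  exact: top_coef_neq0.
rewrite !hval_neq0 // !mulf_eq0 !(negPf (expf_neq0 _ v0)) /=.
case: (eqVneq (num f).[u / v] 0) => // /rootP r.
exact: coprimep_root (num_den_coprime f) r.
Qed.

Lemma P1app_pt f u v : (u != 0) || (v != 0) ->
  P1app f (pt u v) = pt (hval (degree f) (num f) u v) (hval (degree f) (den f) u v).
Proof.
case: (eqVneq v 0) => [->|v0 _].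
  rewrite orbF => u0; have -> : pt u 0 = None by rewrite /pt eqxx.
  by rewrite !hval_v0 -!(mulrC (u ^+ _)) ptZ ?expf_neq0.
have -> : pt u v = Some (u / v) by rewrite /pt (negPf v0).
by rewrite !hval_neq0 // ptZ ?expf_neq0.
Qed.

Lemma comp_coprime f g :
  coprimep (hpoly (degree f) (num f) (num g) (den g))
           (hpoly (degree f) (den f) (num g) (den g)).
Proof.
apply/Pdiv.ClosedField.coprimepP => x /rootP; rewrite !horner_hpoly => E.
have : ((num g).[x] != 0) || ((den g).[x] != 0).
  case: (eqVneq (num g).[x] 0) => // /rootP r.
  exact: coprimep_root (num_den_coprime g) r.
by move/(hval_num_den_neq0 f); rewrite E eqxx.
Qed.

(** The composite [f o g], by substitution into the forms of [f]. *)
Definition P1comp f g : P1map k := MkP1map (comp_coprime f g).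

Lemma degree_comp f g : degree (P1comp f g) = (degree f * degree g)%N.
Proof.
set h := P1comp f g; apply/eqP; rewrite eqn_leq; apply/andP; split.
  by rewrite -ltnS -degree_eq geq_max /= !size_hpoly.
have := hval_num_den_neq0 f (top_coef_neq0 g).
have lt_size (q : {poly k}) j : q`_j != 0 -> (j < size q)%N.
  by rewrite ltnNge; apply: contraNN => /(nth_default 0) ->.
rewrite -!coef_hpoly_top // => /orP[]/lt_size H; rewrite -ltnS.
  exact: leq_trans H (size_num h).
exact: leq_trans H (size_den h).
Qed.

Lemma P1app_comp f g y : P1app (P1comp f g) y = P1app f (P1app g y).
Proof.
rewrite [P1app g y]P1appE P1app_pt ?hval_num_den_neq0 ?rep_neq0 //.
rewrite P1appE degree_comp /=; case: y => [b|] /=; last first.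
  by rewrite !hval_v0 !expr1n !mulr1 !coef_hpoly_top.
rewrite !(@hval_neq0 _ (degree f * degree g)) ?oner_neq0 ?size_hpoly //.
rewrite !(@hval_neq0 _ (degree g)) ?oner_neq0 //.
by rewrite !expr1n !mul1r divr1 !horner_hpoly.
Qed.

Lemma P1app_eqSome f b x :
  P1app f (Some b) = x <-> root (fiber_poly f x) b.
Proof.
rewrite P1appE /= !hval_neq0 ?oner_neq0 // !expr1n !mul1r divr1.
rewrite /root; case: x => [a|] /=; last by rewrite pt_eqoo; split=> /eqP.
rewrite pt_eq ?hornerD ?hornerN ?hornerZ; first by split=> /eqP.
case: (eqVneq (num f).[b] 0) => // /rootP r.
exact: coprimep_root (num_den_coprime f) r.
Qed.

Lemma P1app_eqNone f x :
  P1app f None = x <-> (fiber_poly f x)`_(degree f) = 0.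
Proof.
rewrite P1appE /= !hval_v0 !expr1n !mulr1.
case: x => [a|] /=; last by rewrite pt_eqoo.
by rewrite pt_eq ?top_coef_neq0 // coefB coefZ.
Qed.

Lemma size_fiber f x : (size (fiber_poly f x) <= (degree f).+1)%N.
Proof.
case: x => [a|] //=; apply: leq_trans (size_polyD _ _) _.
by rewrite geq_max size_polyN size_num (leq_trans (size_scale_leq _ _)).
Qed.

Lemma fiber_poly_neq0 f x : (0 < degree f)%N -> fiber_poly f x != 0.
Proof.
have := degree_eq f; have := num_den_coprime f; case: x => [a|] /=.
  move=> cop sz d0; apply/negP; rewrite subr_eq0 => /eqP E.
  have sd : size (den f) = 1%N.
    apply/eqP; rewrite size_poly_eq1.
    apply: (coprimepP _ _ cop) => //; rewrite E -mul_polyC; exact: dvdp_mull.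
  move: sz d0; rewrite E sd (maxn_idPr _); first by case=> <-.
  by rewrite -[leqRHS]sd size_scale_leq.
move=> cop sz d0; apply/negP => /eqP E; move: cop sz.
rewrite E size_poly0 coprimep0 -size_poly_eq1 => /eqP->; lia.
Qed.

(** The values of a rational map do not see a common factor. *)
Lemma P1app_scale f g c : c != 0 -> num f = c *: num g -> den f = c *: den g ->
  P1app f =1 P1app g.
Proof.
move=> c0 En Ed y; have dE : degree f = degree g.
  by rewrite /degree En Ed !size_scale.
by rewrite !P1appE dE En Ed !hvalZ ptZ.
Qed.

(** A rational map is determined by its values, up to a common factor of its
   numerator and denominator. *)
Lemma P1app_eq f g : P1app f =1 P1app g ->
  exists2 c, c != 0 & num f = c *: num g /\ den f = c *: den g.
Proof.
move=> E; have H : num f * den g = num g * den f.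
  apply/eqP; rewrite -subr_eq0; apply/eqP; apply: poly_eq0_horner => b.
  rewrite !hornerE; have := E (Some b); case Ef: (P1app f (Some b)) => [a|].
    move/P1app_eqSome: Ef => /rootP /= + /esym/P1app_eqSome/rootP /=.
    rewrite !hornerE => /eqP; rewrite subr_eq0 => /eqP->.
    by move=> /eqP; rewrite subr_eq0 => /eqP->; ring.
  move/P1app_eqSome: Ef => /rootP /= -> /esym/P1app_eqSome/rootP /= ->.
  by rewrite !mulr0 subrr.
have cf := num_den_coprime f; have cg := num_den_coprime g.
have : den f %= den g.
  rewrite /eqp -(@Gauss_dvdpr _ _ (num f)) 1?coprimep_sym // H dvdp_mull //=.
  by rewrite -(@Gauss_dvdpr _ _ (num g)) 1?coprimep_sym // -H dvdp_mull.
have /eqpP[[a b] /= /andP[a0 b0] Nab] : num f %= num g.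
  rewrite /eqp -(@Gauss_dvdpl _ _ (den f)) // -H dvdp_mulr //=.
  by rewrite -(@Gauss_dvdpl _ _ (den g)) // H dvdp_mulr.
have HN : num f = (b / a) *: num g.
  by rewrite mulrC -scalerA -Nab scalerA mulVf // scale1r.
case/eqpP=> -[a' b'] /= /andP[a'0 b'0] Dab.
have HD : den f = (b' / a') *: den g.
  by rewrite mulrC -scalerA -Dab scalerA mulVf // scale1r.
have c0 : b / a != 0 by rewrite mulf_neq0 ?invr_eq0.
have c0' : b' / a' != 0 by rewrite mulf_neq0 ?invr_eq0.
case: (eqVneq (num g) 0) => [n0|n0].
  by exists (b' / a') => //; rewrite HN n0 !scaler0.
case: (eqVneq (den g) 0) => [d0|d0].
  by exists (b / a) => //; rewrite HD d0 !scaler0.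
exists (b / a) => //; split=> //; rewrite HD; congr (_ *: _).
have : (b / a - b' / a') *: (num g * den g) = 0.
  by rewrite scalerBl scalerAl -HN scalerAr -HD H subrr.
move/eqP; rewrite scaler_eq0 mulf_eq0 (negPf n0) (negPf d0) !orbF subr_eq0.
by move/eqP.
Qed.

Lemma degree_app_eq f g : P1app f =1 P1app g -> degree f = degree g.
Proof.
by case/P1app_eq => c c0 [En Ed]; rewrite /degree En Ed !size_scale.
Qed.

(** Pulling back a fibre along [i] does not lower multiplicities. *)
Lemma ram_index_le f1 f2 i y : (forall y, P1app f2 (P1app i y) = P1app f1 y) ->
  (0 < degree f1)%N -> (ram_index f2 (P1app i y) <= ram_index f1 y)%N.
Proof.
move=> E d0.
have E1 : P1app f1 =1 P1app (P1comp f2 i) by move=> z; rewrite P1app_comp E.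
have [c c0 [/= En Ed]] := P1app_eq E1.
have degE := degree_app_eq E1; rewrite degree_comp in degE.
rewrite /ram_index E degE; set x := P1app f1 y.
have F1E : fiber_poly f1 x = c *: hpoly (degree f2) (fiber_poly f2 x) (num i) (den i).
  case: x => [a|] //=; rewrite hpolyB hpolyZ En Ed scalerBr !scalerA.
  by rewrite [c * a]mulrC.
have F1n0 := fiber_poly_neq0 x d0; have sF1 := size_fiber f1 x.
have d2 : (0 < degree f2)%N by move: d0; rewrite degE; case: (degree f2).
have F2n0 := fiber_poly_neq0 x d2; have sF2 := size_fiber f2 x.
set n := degree f2 in F1E sF2 d2 *; set m := degree i.
set F := fiber_poly f2 x in F1E F2n0 sF2 *.
set e := (X in (X <= _)%N).
have [L [G [HL hE [sL sG]]]] : exists L G,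
    [/\ if y is Some b then L.[b] = 0 else L`_m = 0,
        hpoly n F (num i) (den i) = L ^+ e * hpoly (n - e) G (num i) (den i),
        (size L <= m.+1)%N & (e <= n)%N].
  case Ei: (P1app i y) @e => [b|] e.
    have /dvdpP[G FE] : ('X - b%:P) ^+ e %| F by rewrite -mup_geq.
    have G0 : G != 0 by apply: contraNneq F2n0 => G0; rewrite FE G0 mul0r.
    have sFE : size F = (size G + e)%N.
      by rewrite FE size_Mmonic ?monic_exp ?monicXsubC // size_exp_XsubC addnS.
    have len : (e <= n)%N.
      by have sG0 : (0 < size G)%N; [rewrite size_poly_gt0 | lia].
    exists (num i - b *: den i), G; split=> //.
    - case: y x Ei {E1 F1n0 F2n0 sF1 F1E F sF2 sFE FE e len} => [b'|] x Ei.
        by move/P1app_eqSome: Ei => /rootP.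
      by move/P1app_eqNone: Ei.
    - rewrite -{1}(subnKC len) FE mulrC hpoly_expXsubC //; lia.
    - exact: (size_fiber i (Some b)).
  have sFe : (size F <= (n - e).+1)%N.
    by rewrite /e; have sF0 : (0 < size F)%N; [rewrite size_poly_gt0 | lia].
  have len : (e <= n)%N by rewrite leq_subr.
  exists (den i), F; split=> //.
  - case: y x Ei {E1 F1n0 F2n0 sF1 F1E F sF2 e sFe len} => [b'|] x Ei.
      by move/P1app_eqSome: Ei => /rootP.
    by move/P1app_eqNone: Ei.
  - by rewrite -{1}(subnKC len) hpoly_exp_widen.
case yE: y => [b|]; rewrite yE in HL.
  rewrite mup_geq // F1E hE dvdpZr //; apply: dvdp_mulr.
  by apply: dvdp_exp2r; rewrite dvdp_XsubCl; apply/rootP.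
rewrite F1E hE size_scale //.
have sL' : (size L <= m)%N.
  rewrite leqNgt; apply/negP => sL'.
  have EL : size L = m.+1 by apply/eqP; rewrite eqn_leq sL.
  have : lead_coef L = 0 by rewrite /lead_coef EL.
  by move/eqP; rewrite lead_coef_eq0 -size_poly_eq0 EL.
have m0 : (0 < m)%N by move: d0; rewrite degE -/m; case: (m); rewrite ?muln0.
rewrite -(prednK m0) in sL'.
have H1 := size_exp_bound e sL'.
have H2 := size_hpoly (n - e) G (size_num i) (size_den i).
have H3 := size_polyMleq (L ^+ e) (hpoly (n - e) G (num i) (den i)).
have s0 : (0 < size (L ^+ e * hpoly (n - e) G (num i) (den i))%R)%N.
  by rewrite size_poly_gt0; apply: contraNneq F1n0 => E0; rewrite F1E hE E0 scaler0.
have : (m.-1 * e + (n - e) * m + e = n * m)%N.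
  by rewrite addnAC -mulSnr prednK // [(m * e)%N]mulnC -mulnDl subnKC.
have : (size (L ^+ e * hpoly (n - e) G (num i) (den i))%R + e <= (n * m).+1)%N ->
   (e <= n * m - (size (L ^+ e * hpoly (n - e) G (num i) (den i))%R).-1)%N.
  by clearbody e; lia.
move=> + NE; apply; rewrite -NE.
have aux r s t A B : (r <= A.+1 -> s <= B.+1 -> t <= (r + s).-1 ->
  t + e <= (A + B + e).+1)%N by clearbody e; lia.
exact: aux H1 H2 H3.
Qed.

Definition P1id : P1map k := MkP1map (coprimep1 ('X : {poly k})).

Lemma degree_id : degree P1id = 1%N.
Proof. by rewrite /degree /= size_polyX size_poly1. Qed.

Lemma P1app_id y : P1app P1id y = y.
Proof.
rewrite P1appE degree_id /=.
case: y => [b|] /=; last by rewrite !hval_v0 !coefE mul0r (pt_eqoo _ _).2.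
rewrite !hval_neq0 ?oner_neq0 ?size_polyX ?size_poly1 // !hornerE.
by rewrite /pt ?expr1n ?mul1r oner_eq0 !divr1.
Qed.

Lemma P1iso_degree i : P1iso i -> degree i = 1%N.
Proof.
case=> j [ijK _].
have E : P1app (P1comp j i) =1 P1app P1id.
  by move=> y; rewrite P1app_comp ijK P1app_id.
have := degree_app_eq E; rewrite degree_comp degree_id.
by move/eqP; rewrite muln_eq1 => /andP[_ /eqP].
Qed.

Lemma isomorphic_refl f : isomorphic f f.
Proof.
exists P1id; first by exists P1id; split=> y; rewrite !P1app_id.
by move=> y; rewrite P1app_id.
Qed.

Lemma P1iso_comp f g : P1iso f -> P1iso g -> P1iso (P1comp f g).
Proof.
move=> [f' [fK f'K]] [g' [gK g'K]]; exists (P1comp g' f').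
by split=> y; rewrite !P1app_comp ?fK ?gK ?g'K ?f'K.
Qed.

Lemma isomorphic_sym f1 f2 : isomorphic f1 f2 -> isomorphic f2 f1.
Proof.
case=> i [j [ijK jiK]] E; exists j; first by exists i.
by move=> y; rewrite -E jiK.
Qed.

Lemma isomorphic_trans f1 f2 f3 :
  isomorphic f1 f2 -> isomorphic f2 f3 -> isomorphic f1 f3.
Proof.
case=> i Hi E [j Hj E']; exists (P1comp j i); first exact: P1iso_comp.
by move=> y; rewrite P1app_comp E' E.
Qed.

Lemma isomorphic_degree f1 f2 : isomorphic f1 f2 -> degree f1 = degree f2.
Proof.
case=> i Hi E; rewrite -(muln1 (degree f2)) -(P1iso_degree Hi) -degree_comp.
by apply: degree_app_eq => y; rewrite P1app_comp.
Qed.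

Lemma ram_index_iso f1 f2 i y : P1iso i ->
    (forall y, P1app f2 (P1app i y) = P1app f1 y) -> (0 < degree f1)%N ->
  ram_index f2 (P1app i y) = ram_index f1 y.
Proof.
move=> Hi E d1; apply/eqP; rewrite eqn_leq ram_index_le //=.
have d2 : (0 < degree f2)%N by rewrite -(@isomorphic_degree f1) //; exists i.
case: Hi => j [ijK jiK]; rewrite -{1}(ijK y); apply: ram_index_le => // z.
by rewrite -E jiK.
Qed.

End P1MapTheory.
(** * Wronskians and a Padé problem *)

Section Wronskian.
Variable k : fieldType.
Implicit Types (F G L U P : {poly k}) (a c : k).

(** The Wronskian; for coprime [F] and [G], its zeros are the finite ramified points
   of [F / G]. *)
Definition wronsk F G : {poly k} := F * G^`() - F^`() * G.

Lemma wronskC F G : wronsk G F = - wronsk F G.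
Proof. by rewrite /wronsk; ring. Qed.

Lemma wronsk_subZl F G c : wronsk (F - c *: G) G = wronsk F G.
Proof. by rewrite /wronsk derivB derivZ -!mul_polyC; ring. Qed.

Lemma wronskMM F G L : wronsk (L * F) (L * G) = L ^+ 2 * wronsk F G.
Proof. by rewrite /wronsk !derivM; ring. Qed.

Lemma dvdp_deriv_exp a e F :
  ('X - a%:P) ^+ e.+1 %| F -> ('X - a%:P) ^+ e %| F^`().
Proof.
case/dvdpP => H ->; rewrite derivM deriv_exp derivXsubC mul1r /=.
rewrite dvdp_add ?dvdp_mull ?dvdp_exp2l //.
by rewrite -mulr_natr dvdp_mulr.
Qed.

Lemma dvdp_wronskl a e F G :
  ('X - a%:P) ^+ e %| F -> ('X - a%:P) ^+ e.-1 %| wronsk F G.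
Proof.
case: e => [|e] dF; first by rewrite expr0 dvd1p.
rewrite dvdp_sub ?dvdp_mulr ?dvdp_deriv_exp //.
by apply: dvdp_trans dF; rewrite dvdp_exp2l.
Qed.

(** A common zero of [F] and [G] raises the order of the Wronskian. *)
Lemma dvdp_wronsk_root a e F G :
  ('X - a%:P) ^+ e %| F -> root G a -> ('X - a%:P) ^+ e %| wronsk F G.
Proof.
case: e => [|e] dF rG; first by rewrite expr0 dvd1p.
rewrite dvdp_sub ?(dvdp_mulr _ dF) // exprSr dvdp_mul ?dvdp_XsubCl //.
exact: dvdp_deriv_exp.
Qed.

Lemma leq_size_deriv_pred F : (size F^`() <= (size F).-1)%N.
Proof.
case: (eqVneq F 0) => [->|F0]; first by rewrite deriv0 size_poly0.
by have := lt_size_deriv F0; case: (size F).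
Qed.

Lemma size_wronsk F G s t : (size F <= s.+1)%N -> (size G <= t.+1)%N ->
  (size (wronsk F G) <= s + t)%N.
Proof.
have aux (A B : {poly k}) (s' t' : nat) : (size A <= s'.+1)%N -> (size B <= t'.+1)%N ->
  (size (A * B^`())%R <= s' + t')%N.
  move=> sA sB; case: (posnP t') => [b0|b0].
    have : (size B <= 1)%N by rewrite -[1%N]/(0.+1) -[X in X.+1]b0.
    by move/size1_polyC ->; rewrite derivC mulr0 size_poly0.
  have sB' : (size B^`() <= t')%N.
    by apply: leq_trans (leq_size_deriv_pred _) _; case: (size B) sB.
  apply: leq_trans (size_polyMleq _ _) _.
  by rewrite -[(s' + t')%N]/((s'.+1 + t').-1) -!subn1 leq_sub2r // leq_add.
move=> sF sG; apply: leq_trans (size_polyD _ _) _.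
by rewrite size_polyN geq_max aux //= mulrC addnC aux.
Qed.

End Wronskian.

Section WronskianChar.
Variables (k : fieldType) (p : nat).
Hypothesis char_k : p \in [pchar k].
Implicit Types (F G : {poly k}) (a c : k).

(** In characteristic [p], nonzero polynomials of degree less than [p] with zero
   Wronskian have the same degree. *)
Lemma wronsk_eq0_size F G : F != 0 -> G != 0 -> (size F <= p)%N ->
  (size G <= p)%N -> wronsk F G = 0 -> size F = size G.
Proof.
move=> F0 G0 sF sG W0; set s := (size F).-1; set t := (size G).-1.
have p0 : (0 < p)%N by apply: prime_gt0 (pcharf_prime char_k).
have sFE : size F = s.+1 by rewrite prednK // size_poly_gt0.
have sGE : size G = t.+1 by rewrite prednK // size_poly_gt0.
have sXd (H : {poly k}) r : size H = r.+1 -> (size ('X * H^`())%R <= r.+1)%N.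
  move=> sH; rewrite mulrC; case: (eqVneq H^`() 0) => [->|H'0].
    by rewrite mul0r size_poly0.
  by rewrite size_mulX // ltnS; have := leq_size_deriv_pred H; rewrite sH.
have cXd (H : {poly k}) r : ('X * H^`())`_r = H`_r *+ r.
  by rewrite coefXM coef_deriv; case: r => [|r] /=; rewrite ?mulr0n.
(* compare the coefficients of degree [s + t] *)
have : (F * ('X * G^`()) - ('X * F^`()) * G)`_(s + t) = 0.
  by rewrite mulrCA -mulrA -mulrBr -/(wronsk F G) W0 mulr0 coef0.
rewrite coefB !coefM_top ?sFE ?sGE ?sXd // !cXd mulrnAr mulrnAl.
rewrite -mulr_natr -[X in _ - X]mulr_natr -mulrBr => /eqP.
rewrite !mulf_eq0 -[F`_s]/(lead_coef F) -[G`_t]/(lead_coef G) !lead_coef_eq0.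
rewrite (negPf F0) (negPf G0) /= subr_eq0 => /eqP E; congr S.
have lt_p : (s < p)%N /\ (t < p)%N by rewrite -sFE -sGE.
have inj i j : (i <= j < p)%N -> i%:R = j%:R :> k -> i = j.
  move=> /andP[le_ij lt_jp] Eij; apply/eqP; rewrite eqn_leq le_ij /= -subn_eq0.
  have : (p %| j - i)%N by rewrite (dvdn_pcharf char_k) natrB // Eij subrr.
  by case: posnP => // ij0 /(dvdn_leq ij0); rewrite leqNgt (leq_ltn_trans (leq_subr _ _)).
case: lt_p => s_p t_p; case: (leqP s t) => st; first by rewrite (inj s t) ?st.
by rewrite (inj t s) // (ltnW st).
Qed.

End WronskianChar.
Section Pade.
Variable k : fieldType.
Implicit Types (U P q : {poly k}) (a c : k).

(** More polynomials than the degree of [q] are linearly dependent modulo [q]. *)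
Lemma linear_dep_modp N q (g : 'I_N -> {poly k}) : q != 0 -> (size q <= N)%N ->
  exists2 v : 'rV[k]_N, v != 0 & q %| \sum_i v 0 i *: g i.
Proof.
move=> q0 sq; pose M := \matrix_i (poly_rV (g i %% q) : 'rV_(size q).-1).
have sq0 : (0 < size q)%N by rewrite size_poly_gt0.
have K0 : kermx M != 0.
  rewrite kermx_eq0 neq_ltn; apply/orP; left.
  apply: leq_ltn_trans (rank_leq_col M) _; lia.
exists (nz_row (kermx M)); first by rewrite nz_row_eq0.
set v := nz_row _; have /sub_kermxP vM : (v <= kermx M)%MS := nz_row_sub _.
rewrite /dvdp; apply/eqP; have <- : rVpoly (v *m M) = (\sum_i v 0 i *: g i) %% q.
  have -> : v *m M = \sum_i v 0 i *: row i M by rewrite mulmx_sum_row.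
  rewrite linear_sum /= (big_morph (fun r => r %% q) (@modpD _ q) (mod0p q)).
  apply: eq_bigr => i _.
  rewrite linearZ /= rowK poly_rV_K ?modpZl //.
  by rewrite -ltnS prednK // ltn_modp.
by rewrite vM linear0.
Qed.

(** [(U, P)] solves the Padé problem when [P / U] vanishes to order [e1] at 0
   and takes the value 1 to order [e2] at 1, within the given degrees. *)
Definition pade (m n e1 e2 : nat) U P :=
  [/\ (size U <= m.+1)%N, (size P <= n.+1)%N,
      ('X - 0%:P) ^+ e1 %| P & ('X - 1%:P) ^+ e2 %| U - P].

(** The unknown coefficients outnumber the [e2] conditions at 1 by one. *)
Lemma pade_exists m n e1 e2 : (e1 <= n)%N -> (m + n + 1 = e1 + e2)%N ->
  exists U P, pade m n e1 e2 U P /\ (U, P) <> (0, 0).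
Proof.
move=> le_e1 mne; pose a := (n.+1 - e1)%N.
pose g (i : 'I_(m.+1 + a)) : {poly k} :=
  match fintype.split i with inl j => 'X^j | inr j => - ('X - 0%:P) ^+ e1 * 'X^j end.
have [||v v0] := @linear_dep_modp _ (('X - 1%:P) ^+ e2) g.
- by rewrite expf_neq0 ?polyXsubC_eq0.
- by rewrite size_exp_XsubC /a; lia.
pose U := \poly_(j < m.+1) (if insub j is Some j' then v 0 (lshift a j') else 0).
pose P0 := \poly_(j < a) (if insub j is Some j' then v 0 (rshift m.+1 j') else 0).
pose P := ('X - 0%:P) ^+ e1 * P0.
have -> : \sum_i v 0 i *: g i = U - P.
  rewrite big_split_ord /= /U /P /P0 !poly_def mulr_sumr -sumrN.
  congr (_ + _); apply: eq_bigr => j _.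
    rewrite /g (unsplitK (inl j : _ + _)) insubT /= ?ltn_ord // => H.
    by congr (v _ _ *: _); apply: val_inj.
  rewrite /g (unsplitK (inr j : _ + _)) insubT /= ?ltn_ord // => H.
  rewrite mulNr scalerN -scalerAr; congr (- (v _ _ *: _)); exact: val_inj.
move=> dvd; exists U, P; split.
  split=> //; first exact: size_poly.
    apply: leq_trans (size_polyMleq _ _) _; rewrite size_exp_XsubC /=.
    have aux (r : nat) : (r <= a -> (e1.+1 + r).-1 <= n.+1)%N by rewrite /a; lia.
    exact/aux/size_poly.
  exact: dvdp_mulr.
case=> U0 /eqP; rewrite mulf_eq0 expf_eq0 polyXsubC_eq0 andbF /= => /eqP P00.
case/eqP: v0; apply/rowP => i; rewrite mxE -(splitK i) /=; case: (fintype.split i) => j /=.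
  have := coef0 k j; rewrite -U0 coef_poly ltn_ord insubT ?ltn_ord // => H.
  by move=> <-; congr (v _ _); apply: val_inj.
have := coef0 k j; rewrite -P00 coef_poly ltn_ord insubT ?ltn_ord // => H.
by move=> <-; congr (v _ _); apply: val_inj.
Qed.

Lemma dvdp_coprime_exp (e1 e2 : nat) (a b : k) q : a != b ->
  ('X - a%:P) ^+ e1 %| q -> ('X - b%:P) ^+ e2 %| q ->
  ('X - a%:P) ^+ e1 * ('X - b%:P) ^+ e2 %| q.
Proof.
move=> ab d1 d2; rewrite Gauss_dvdp ?d1 //.
by rewrite coprimep_expl // coprimep_expr // coprimep_XsubC root_XsubC eq_sym.
Qed.

(** The Wronskian has degree at most [m + n - 1], which the prescribed zeros
   exhaust. *)
Lemma pade_wronsk m n e1 e2 U P : (0 < e1)%N -> (0 < e2)%N ->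
  (m + n + 1 = e1 + e2)%N -> pade m n e1 e2 U P ->
  exists c, wronsk U P = c *: (('X - 0%:P) ^+ e1.-1 * ('X - 1%:P) ^+ e2.-1).
Proof.
move=> e10 e20 mne [sU sP dP dUP].
have d1 : ('X - 0%:P) ^+ e1.-1 %| wronsk U P.
  by rewrite wronskC dvdpNr dvdp_wronskl.
have d2 : ('X - 1%:P) ^+ e2.-1 %| wronsk U P.
  by rewrite -(wronsk_subZl U P 1) scale1r dvdp_wronskl.
have := dvdp_coprime_exp _ d1 d2; rewrite eq_sym oner_neq0 => /(_ isT)/dvdpP[Q WE].
case: (eqVneq Q 0) => [Q0|Q0].
  by exists 0; rewrite WE Q0 mul0r scale0r.
have : (size Q <= 1)%N.
  have := size_wronsk sU sP; rewrite WE size_Mmonic //; last first.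
    by rewrite monicMl ?monic_exp ?monicXsubC.
  rewrite size_Mmonic ?monic_exp ?monicXsubC ?expf_neq0 ?polyXsubC_eq0 //.
  by rewrite !size_exp_XsubC; lia.
by move/size1_polyC => QE; exists Q`_0; rewrite WE QE coefC eqxx mul_polyC.
Qed.

(** Cross-multiplied, two solutions differ by a polynomial with more zeros than
   its degree. *)
Lemma pade_unique m n e1 e2 U P U1 P1 : (m + n + 1 = e1 + e2)%N ->
  pade m n e1 e2 U P -> pade m n e1 e2 U1 P1 -> U1 * P = P1 * U.
Proof.
move=> mne [sU sP dP dUP] [sU1 sP1 dP1 dUP1].
apply/eqP; rewrite -subr_eq0; apply: contraT => D0.
have d1 : ('X - 0%:P) ^+ e1 %| U1 * P - P1 * U.
  by apply: dvdp_sub; [apply: dvdp_mull | apply: dvdp_mulr].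
have d2 : ('X - 1%:P) ^+ e2 %| U1 * P - P1 * U.
  have -> : U1 * P - P1 * U = (U1 - P1) * P - P1 * (U - P) by ring.
  by apply: dvdp_sub; [apply: dvdp_mulr | apply: dvdp_mull].
have := dvdp_coprime_exp _ d1 d2; rewrite eq_sym oner_neq0 => /(_ isT)/(dvdp_leq D0).
rewrite size_Mmonic ?monic_exp ?monicXsubC ?expf_neq0 ?polyXsubC_eq0 //.
rewrite !size_exp_XsubC.
have H1 := size_polyMleq U1 P; have H2 := size_polyMleq P1 U.
have H3 := size_polyD (U1 * P) (- (P1 * U)); rewrite size_polyN in H3.
have aux (r s t : nat) : (r <= maxn s t -> s <= m + n + 1 -> t <= m + n + 1 ->
  (e1.+1 + e2.+1).-1 <= r -> false)%N by lia.
move=> H4; rewrite (aux _ _ _ H3 _ _ H4) //.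
  by apply: leq_trans H1 _; lia.
by apply: leq_trans H2 _; lia.
Qed.

End Pade.
Section PadeChar.
Variables (k : closedFieldType) (p : nat).
Hypothesis char_k : p \in [pchar k].
Implicit Types (U P F G q R : {poly k}) (a c r mu lam : k).

Lemma dvdp_exp_XsubCM a (e s : nat) q : ~~ root q a ->
  (('X - a%:P) ^+ e %| ('X - a%:P) ^+ s * q) = (e <= s)%N.
Proof.
move=> rq; have q0 : q != 0 by apply: contraNneq rq => ->; rewrite root0.
rewrite -mup_geq ?mulf_neq0 ?expf_neq0 ?polyXsubC_eq0 //.
by rewrite mupMl // mup_XsubCX eqxx.
Qed.

Lemma nroot_exp_XsubC a (e : nat) r : r != a -> ~~ root (('X - a%:P) ^+ e) r.
Proof.
by move=> ra; rewrite rootE horner_exp hornerXsubC expf_eq0 subr_eq0 (negPf ra) andbF.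
Qed.

(** A solution of the Padé problem in lowest terms, of full degree, and ramified
   exactly as prescribed; [P / U] is then unramified away from 0, 1 and infinity. *)
Definition exact_pade (m n e1 e2 : nat) U P :=
  [/\ pade m n e1 e2 U P, size U = m.+1, size P = n.+1, coprimep U P
    & exists2 c, c != 0 &
      wronsk U P = c *: (('X - 0%:P) ^+ e1.-1 * ('X - 1%:P) ^+ e2.-1)].

(** The point is that the Wronskian is not 0; the rest follows by comparing
   degrees and orders of vanishing. *)
Lemma exact_pade_exists m n e1 e2 : (0 < e1 <= n)%N -> (0 < e2 <= n)%N ->
    (m + n + 1 = e1 + e2)%N -> (n < p)%N ->
  exists U P, exact_pade m n e1 e2 U P.
Proof.
move=> /andP[e10 le_e1] /andP[e20 le_e2] mne lt_np.
have [U [P [pUP UP0]]] := pade_exists k le_e1 mne.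
exists U, P; have [sU sP dP dUP] := pUP.
have [c Wc] := pade_wronsk e10 e20 mne pUP.
have sz_lt (a : k) e q : q != 0 -> ('X - a%:P) ^+ e %| q -> (e < size q)%N.
  by move=> q0 /(dvdp_leq q0); rewrite size_exp_XsubC.
have P0 : P != 0.
  apply/eqP => P0; case: (eqVneq U 0) => [U0|U0]; first by apply: UP0; rewrite U0 P0.
  by rewrite P0 subr0 in dUP; have := leq_trans (sz_lt _ _ _ U0 dUP) sU; clear -le_e1 mne; lia.
have U0 : U != 0.
  apply/eqP => U0; rewrite U0 sub0r dvdpNr in dUP.
  have := dvdp_coprime_exp _ dP dUP; rewrite eq_sym oner_neq0 => /(_ isT)/(dvdp_leq P0).
  rewrite size_Mmonic ?monic_exp ?monicXsubC ?expf_neq0 ?polyXsubC_eq0 //.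
  rewrite !size_exp_XsubC => /leq_trans/(_ sP); clear -mne; lia.
have c0 : c != 0.
  apply/eqP => c0; rewrite c0 scale0r in Wc.
  have sUP : size U = size P.
    apply: (wronsk_eq0_size char_k) => //.
      by apply: leq_trans sU _; move: mne lt_np le_e1 le_e2; clear; lia.
    exact: leq_trans sP _.
  (* a multiple of [U] cancels the leading term of [P]: the difference vanishes *)
  pose b := lead_coef P / lead_coef U; pose D := P - b *: U.
  have b0 : b != 0 by rewrite mulf_neq0 ?invr_eq0 ?lead_coef_eq0.
  have PE : P = b *: U.
    apply/eqP; rewrite -subr_eq0 -/D; apply: contraT => D0.
    have WD : wronsk D U = 0 by rewrite /D wronsk_subZl wronskC Wc oppr0.
    have sD : (size D < size U)%N.
      have D_lt : D`_(size U).-1 = 0.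
        rewrite coefB coefZ -/(lead_coef U) {1}sUP -/(lead_coef P).
        by rewrite divfK ?subrr // lead_coef_eq0.
      have sD : (size D <= size U)%N.
        apply: leq_trans (size_polyD _ _) _.
        by rewrite size_polyN size_scale // sUP maxnn.
      rewrite ltn_neqAle sD andbT; apply: contraNneq D0 => sDE.
      by rewrite -lead_coef_eq0 /lead_coef sDE D_lt.
    have sUp : (size U <= p)%N by rewrite sUP; apply: leq_trans sP _.
    have := wronsk_eq0_size char_k D0 U0 (leq_trans (ltnW sD) sUp) sUp WD.
    by move=> E; rewrite E ltnn in sD.
  rewrite PE dvdpZr // in dP.
  by have := leq_trans (sz_lt _ _ _ U0 dP) sU; clear -le_e2 mne; lia.
have sW : size (wronsk U P) = (m + n)%N.
  rewrite Wc size_scale // size_Mmonic ?monic_exp ?monicXsubC ?expf_neq0 ?polyXsubC_eq0 //.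
  rewrite !size_exp_XsubC; move: mne e10 e20; clear; lia.
have W01 : (m + n > 0)%N by clear -e10 e20 mne le_e1; lia.
have sU' : size U = m.+1.
  apply/eqP; rewrite eqn_leq sU ltnNge; apply/negP => sU'.
  have m0 : (0 < m)%N by apply: leq_trans sU'; rewrite size_poly_gt0.
  rewrite -(prednK m0) in sU'.
  by have := size_wronsk sU' sP; rewrite sW; clear -m0; lia.
have sP' : size P = n.+1.
  apply/eqP; rewrite eqn_leq sP ltnNge; apply/negP => sP'.
  have n0 : (0 < n)%N by apply: leq_trans sP'; rewrite size_poly_gt0.
  rewrite -(prednK n0) in sP'.
  by have := size_wronsk sU sP'; rewrite sW; clear -n0; lia.
split=> //; last by exists c.
apply/Pdiv.ClosedField.coprimepP => r rU; apply/negP => rP.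
case: (eqVneq r 0) => [r0|r0].
  have : ('X - 0%:P) ^+ e1 %| wronsk U P.
    by rewrite wronskC dvdpNr dvdp_wronsk_root // -r0.
  rewrite Wc dvdpZr // dvdp_exp_XsubCM ?nroot_exp_XsubC 1?eq_sym ?oner_neq0 //.
  by move: e10; clear; lia.
case: (eqVneq r 1) => [r1|r1].
  have : ('X - 1%:P) ^+ e2 %| wronsk U P.
    by rewrite -(wronsk_subZl U P 1) scale1r dvdp_wronsk_root // -r1.
  rewrite Wc dvdpZr // mulrC dvdp_exp_XsubCM ?nroot_exp_XsubC ?oner_neq0 //.
  by move: e20; clear; lia.
have : root (wronsk U P) r.
  rewrite rootE /wronsk hornerD hornerN !hornerM.
  by rewrite (eqP rP) (eqP rU) mul0r mulr0 subrr.
rewrite Wc rootZ // rootM (negPf (nroot_exp_XsubC _ r0)).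
by rewrite (negPf (nroot_exp_XsubC _ r1)).
Qed.

Lemma exp_XsubC_pchar a : ('X - a%:P) ^+ p = 'X ^+ p - (a ^+ p)%:P.
Proof.
have ch : p \in [pchar {poly k}] by rewrite pchar_poly.
by rewrite -!(pFrobenius_autE ch) pFrobenius_autB_comm ?rmorphXn //; apply: mulrC.
Qed.

Lemma pred_charK : p.-1.+1 = p.
Proof. by rewrite prednK // prime_gt0 // (pcharf_prime char_k). Qed.

Lemma deriv_Xp_mul F : ('X ^+ p * F)^`() = 'X ^+ p * F^`().
Proof.
have ch : p \in [pchar {poly k}] by rewrite pchar_poly.
by rewrite derivM derivXn mulrn_pchar // mul0r add0r.
Qed.

(** With [g = P / U], the equation [lam = mu ^ p * (1 - g mu) / (mu ^ p - g mu)]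
   in [mu], cleared of denominators. *)
Definition lam_poly U P lam : {poly k} :=
  (lam%:P - 'X ^+ p) * P + (1 - lam)%:P * 'X ^+ p * U.

Lemma horner_lam_poly U P lam mu :
  (lam_poly U P lam).[mu] = (lam - mu ^+ p) * P.[mu] + (1 - lam) * mu ^+ p * U.[mu].
Proof. by rewrite /lam_poly !hornerE. Qed.

Lemma deriv_lam_poly U P lam : (lam_poly U P lam)^`() =
  (lam%:P - 'X ^+ p) * P^`() + (1 - lam)%:P * 'X ^+ p * U^`().
Proof.
rewrite /lam_poly mulrBl -mulrA derivD derivB !deriv_mulC !deriv_Xp_mul; ring.
Qed.

Lemma wronsk_lam_polyU U P lam :
  wronsk (lam_poly U P lam) U = (lam%:P - 'X ^+ p) * wronsk P U.
Proof.
by rewrite /wronsk deriv_lam_poly /lam_poly; ring.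
Qed.

Lemma wronsk_lam_polyP U P lam :
  wronsk (lam_poly U P lam) P = (1 - lam)%:P * 'X ^+ p * wronsk U P.
Proof.
by rewrite /wronsk deriv_lam_poly /lam_poly; ring.
Qed.

(** Besides 0 and 1, there are [p - 1 - m] zeros: the degree is [p + n], the orders
   at 0 and 1 are exactly [e1] and [e2], and the other zeros are simple. All the
   orders are read off the Wronskians with [U] and with [P]. *)
Lemma lam_poly_roots m n e1 e2 U P lam : lam != 0 -> lam != 1 ->
    (0 < e1 <= p)%N -> (0 < e2 <= p)%N -> (m < n)%N ->
    (m + n + 1 = e1 + e2)%N -> (m < p)%N -> exact_pade m n e1 e2 U P ->
  exists rs : seq k, [/\ uniq rs, size rs = (p - 1 - m)%N &
    forall r, r \in rs = [&& r != 0, r != 1 & root (lam_poly U P lam) r]].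
Proof.
move=> l0 l1 /andP[e10 e1p] /andP[e20 e2p] lt_mn mne lt_mp.
move=> [[_ _ dP dUP] sU sP cop [c c0 Wc]].
have l1' : 1 - lam != 0 by rewrite subr_eq0 eq_sym.
set H := lam_poly U P lam.
have XpE : 'X ^+ p = ('X - 0%:P) ^+ p :> {poly k} by rewrite subr0.
have d1 : ('X - 0%:P) ^+ e1 %| H.
  rewrite dvdp_add ?(dvdp_mull _ dP) // -mulrA mulrCA dvdp_mulr //.
  by rewrite XpE dvdp_exp2l.
have d2 : ('X - 1%:P) ^+ e2 %| H.
  have -> : H = - (lam%:P - 'X ^+ p) * (U - P) - lam%:P * (('X - 1%:P) ^+ p * U).
    rewrite exp_XsubC_pchar expr1n /H /lam_poly; ring.
  by rewrite dvdp_sub ?(dvdp_mull _ dUP) // mulrCA dvdp_mulr // dvdp_exp2l.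
have sH : size H = (p + n.+1)%N.
  have -> : H = - ('X ^+ p * P) + (lam%:P * P + (1 - lam)%:P * ('X ^+ p * U)).
    by rewrite /H /lam_poly; ring.
  have P0 : P != 0 by rewrite -size_poly_gt0 sP.
  have U0 : U != 0 by rewrite -size_poly_gt0 sU.
  have sXp q : q != 0 -> size ('X ^+ p * q) = (p + size q)%N.
    by move=> q0; rewrite size_monicM ?monicXn // size_polyXn.
  rewrite size_polyDl size_polyN sXp // sP //.
  apply: leq_ltn_trans (size_polyD _ _) _.
  rewrite !mul_polyC !size_scale // sXp // sP sU.
  by rewrite gtn_max; move: lt_mn (pred_charK); clear; lia.
have [R HE] : exists R, H = ('X - 0%:P) ^+ e1 * ('X - 1%:P) ^+ e2 * R.
  have := dvdp_coprime_exp _ d1 d2; rewrite eq_sym oner_neq0 => /(_ isT)/dvdpP[R ->].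
  by exists R; rewrite mulrC.
have H0 : H != 0 by rewrite -size_poly_gt0 sH addnS.
have R0 : R != 0 by apply: contraNneq H0 => R0; rewrite HE R0 mulr0.
have sR : size R = (p - 1 - m).+1.
  have := sH; rewrite HE size_monicM //; last first.
    by rewrite monicMl ?monic_exp ?monicXsubC.
  rewrite size_Mmonic ?monic_exp ?monicXsubC ?expf_neq0 ?polyXsubC_eq0 //.
  rewrite !size_exp_XsubC; move: mne lt_mp; clear; lia.
have WU := wronsk_lam_polyU U P lam; rewrite -/H [wronsk P U]wronskC Wc in WU.
have WP := wronsk_lam_polyP U P lam; rewrite -/H Wc in WP.
have R00 : ~~ root R 0.
  apply/negP => rR.
  have : ('X - 0%:P) ^+ e1.+1 %| H.
    by rewrite HE exprSr -[X in _ %| X]mulrA dvdp_mul // dvdp_mull // dvdp_XsubCl.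
  move/dvdp_wronskl => /(_ U); rewrite /= WU.
  have -> : (lam%:P - 'X^p) * - (c *: (('X - 0%:P) ^+ e1.-1 * ('X - 1%:P) ^+ e2.-1)) =
     - c *: (('X - 0%:P) ^+ e1.-1 * ((lam%:P - 'X^p) * ('X - 1%:P) ^+ e2.-1)).
    by rewrite -!mul_polyC; ring.
  rewrite dvdpZr ?oppr_eq0 // dvdp_exp_XsubCM; first by move: e10; clear; lia.
  rewrite rootM negb_or nroot_exp_XsubC 1?eq_sym ?oner_neq0 // andbT.
  by rewrite rootE !hornerE expr0n -pred_charK /= subr0.
have R01 : ~~ root R 1.
  apply/negP => rR.
  have : ('X - 1%:P) ^+ e2.+1 %| H.
    rewrite HE exprSr mulrAC -[X in _ %| X]mulrA [R * _]mulrC mulrA.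
    by rewrite dvdp_mul ?dvdp_mull // dvdp_XsubCl.
  move/dvdp_wronskl => /(_ U); rewrite /= WU.
  have -> : (lam%:P - 'X^p) * - (c *: (('X - 0%:P) ^+ e1.-1 * ('X - 1%:P) ^+ e2.-1)) =
     - c *: (('X - 1%:P) ^+ e2.-1 * ((lam%:P - 'X^p) * ('X - 0%:P) ^+ e1.-1)).
    by rewrite -!mul_polyC; ring.
  rewrite dvdpZr ?oppr_eq0 // dvdp_exp_XsubCM; first by move: e20; clear; lia.
  rewrite rootM negb_or nroot_exp_XsubC ?oner_neq0 // andbT.
  by rewrite rootE !hornerE expr1n subr_eq0.
have sepR : separable_poly R.
  rewrite unlock; apply/Pdiv.ClosedField.coprimepP => r rR; apply/negP => rR'.
  have r0 : r != 0 by apply: contraNneq R00 => <-.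
  have r1 : r != 1 by apply: contraNneq R01 => <-.
  have rH : root H r by rewrite HE rootM rR orbT.
  have rH' : root H^`() r.
    by rewrite HE derivM rootE hornerD !hornerM (eqP rR) (eqP rR') !mulr0 addr0.
  have : root (wronsk H P) r.
    by rewrite rootE /wronsk hornerD hornerN !hornerM (eqP rH) (eqP rH') !mul0r subrr.
  rewrite WP !(rootM, rootZ) // (negPf (nroot_exp_XsubC _ r0)).
  rewrite (negPf (nroot_exp_XsubC _ r1)) !orbF rootC (negPf l1') /=.
  by rewrite XpE (negPf (nroot_exp_XsubC _ r0)).
have [rs RE] := closed_field_poly_normal R.
have lR0 : lead_coef R != 0 by rewrite lead_coef_eq0.
have rsR r : (r \in rs) = root R r by rewrite RE rootZ // root_prod_XsubC.
exists rs; split.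
- by rewrite -separable_prod_XsubC -(eqp_separable (eqp_scale _ lR0)) -RE.
- by have := sR; rewrite RE size_scale // size_prod_XsubC => -[].
- move=> r; rewrite rsR HE !rootM.
  case: (eqVneq r 0) => [->|r0]; first by rewrite (negPf R00).
  case: (eqVneq r 1) => [->|r1]; first by rewrite (negPf R01).
  by rewrite (negPf (nroot_exp_XsubC _ r0)) (negPf (nroot_exp_XsubC _ r1)).
Qed.

End PadeChar.
(** * A criterion for the ramification type *)

Section Criterion.
Variables (k : closedFieldType) (p : nat).
Hypothesis char_k : p \in [pchar k].
Implicit Types (f : P1map k) (a c r mu lam : k).

Lemma wronsk_fiber f x : exists2 c, c != 0 &
  exists G, wronsk (num f) (den f) = c *: wronsk (fiber_poly f x) G.
Proof.
case: x => [a|] /=.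
  by exists 1; rewrite ?oner_neq0 //; exists (den f); rewrite scale1r wronsk_subZl.
exists (-1); first by rewrite oppr_eq0 oner_neq0.
by exists (num f); rewrite scaleN1r -wronskC.
Qed.

Lemma ram_index_gt0 f y : (0 < degree f)%N -> (0 < ram_index f y)%N.
Proof.
move=> d0; rewrite /ram_index; case: y => [b|].
  by rewrite -XsubC_dvd ?fiber_poly_neq0 // dvdp_XsubCl; apply/P1app_eqSome.
have F0 := fiber_poly_neq0 (P1app f None) d0.
have E : (fiber_poly f (P1app f None))`_(degree f) = 0 by apply/P1app_eqNone.
rewrite subn_gt0 ltn_neqAle; apply/andP; split.
  by apply: contra_eq_neq E => <-; rewrite -/(lead_coef _) lead_coef_eq0.
by have := size_fiber f (P1app f None); case: (size _).
Qed.

(** The order of the Wronskian bounds the finite ramification indices. *)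
Lemma ram_index_wronsk f b e : (0 < degree f)%N ->
  ~~ (('X - b%:P) ^+ e %| wronsk (num f) (den f)) ->
  (ram_index f (Some b) <= e)%N.
Proof.
move=> d0 ndvd; rewrite /ram_index mup_leq ?fiber_poly_neq0 //.
apply: contra ndvd => /dvdp_wronskl dvd.
have [c c0 [G ->]] := wronsk_fiber f (P1app f (Some b)).
by rewrite dvdpZr.
Qed.

Lemma ram_index_geq f b x e : P1app f (Some b) = x -> (0 < degree f)%N ->
  ('X - b%:P) ^+ e %| fiber_poly f x -> (e <= ram_index f (Some b))%N.
Proof. by move=> fb d0 dvd; rewrite /ram_index fb mup_geq ?fiber_poly_neq0. Qed.

(** A nonzero Wronskian, here with its zeros made explicit, forces separability. *)
Lemma separable_map_wronsk f c (s : seq k) : c != 0 ->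
  wronsk (num f) (den f) = c *: \prod_(b <- s) ('X - b%:P) -> Defs.separable_map f.
Proof.
move=> c0 W; rewrite /Defs.separable_map.
pose phi : {rmorphism k -> {fraction {poly k}}} := @tofrac {poly k} \o @polyC k.
rewrite -[fun a : k => _]/(phi : _ -> _) /=.
set t := tofrac 'X; set N := map_poly phi (num f); set D := map_poly phi (den f).
rewrite unlock.
have WE : wronsk (N - t *: D) D = phi c *: \prod_(b <- s) ('X - (phi b)%:P).
  rewrite wronsk_subZl /wronsk !deriv_map -!rmorphM -rmorphB -/(wronsk _ _) W /=.
  rewrite map_polyZ rmorph_prod; congr (_ *: _); apply: eq_bigr => b _.
  by rewrite /= rmorphB /= map_polyX map_polyC.
set F := N - t *: D.
(* a common factor of [F] and its derivative divides the Wronskian, so that it has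
   a zero [b] in [k]; but [num f - t den f] has none, [t] being transcendental *)
have cFW : coprimep F (wronsk F D).
  rewrite WE coprimepZr ?fmorph_eq0 //.
  elim: s {W WE} => [|b s IH]; first by rewrite big_nil coprimep1.
  rewrite big_cons coprimepMr IH andbT coprimep_XsubC.
  apply/negP => /rootP; rewrite /F hornerD hornerN hornerZ !horner_map /= => /eqP.
  rewrite subr_eq0 => /eqP.
  rewrite /t -rmorphM => /eqP; rewrite tofrac_eq => /eqP E.
  have Db : (den f).[b] = 0.
    have := congr1 (fun q : {poly k} => q`_1) E.
    by rewrite coefC coefXM /= coefC /= => ->.
  have Nb : (num f).[b] = 0.
    by move: E; rewrite Db polyC0 mulr0 => /eqP; rewrite polyC_eq0 => /eqP.
  have rN : root (num f) b by apply/rootP.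
  by have := coprimep_root (num_den_coprime f) rN; rewrite Db eqxx.
have : coprimep F (F^`() * D).
  have -> : F^`() * D = D^`() * F + (-1) *: wronsk F D.
    by rewrite scaleN1r /wronsk; ring.
  by rewrite coprimep_addl_mul coprimepZr ?oppr_eq0 ?oner_eq0.
by rewrite coprimepMr => /andP[].
Qed.

(** [y] is a ramified point over [x]. *)
Definition ram_pt f (y x : P1 k) := P1app f y = x /\ ramified f y.

(** Multiplicities that already account for the whole Wronskian are the actual
   ramification indices. *)
Lemma ramification_criterion f lam mu d e1 e2 e3 e4 c : lam != 0 -> lam != 1 ->
    mu != 0 -> mu != 1 -> c != 0 ->
    (1 < e1 < p)%N -> (1 < e2 < p)%N -> (1 < e3 < p)%N -> (1 < e4 < p)%N ->
    size (num f) = d.+1 -> (size (den f) + e3)%N = d.+1 ->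
    ('X - 0%:P) ^+ e1 %| num f -> ('X - 1%:P) ^+ e2 %| num f - den f ->
    ('X - mu%:P) ^+ e4 %| num f - lam *: den f ->
    wronsk (num f) (den f) = c *: (('X - 0%:P) ^+ e1.-1 *
      ('X - 1%:P) ^+ e2.-1 * ('X - mu%:P) ^+ e4.-1) ->
  has_ramification_type lam d [tuple e1; e2; e3; e4] f /\
  [/\ ram_pt f (Some 0) (Some 0), ram_pt f (Some 1) (Some 1),
      ram_pt f None None & ram_pt f (Some mu) (Some lam)].
Proof.
move=> l0 l1 m0 m1 c0 /andP[h1 h1p] /andP[h2 h2p] /andP[h3 h3p] /andP[h4 h4p].
move=> sN sD d1 d2 d4 W.
have degf : degree f = d.
  by rewrite /degree (maxn_idPl _) sN //= -sD leq_addr.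
have d0 : (0 < degree f)%N.
  rewrite degf; have D0 : den f != 0.
    by apply: contraNneq c0 => D0; move: W;
      rewrite D0 /wronsk deriv0 mulr0 mulr0 subrr => /esym/eqP;
      rewrite scaler_eq0 !mulf_eq0 !expf_eq0 !polyXsubC_eq0 !andbF !orbF.
  have sD0 : (0 < size (den f))%N by rewrite size_poly_gt0.
  by move: sD sD0 h3; clear; lia.
have zero_of b e F : (1 < e)%N -> ('X - b%:P) ^+ e %| F -> root F b.
  move=> h; rewrite -dvdp_XsubCl; apply: dvdp_trans.
  by rewrite -{1}(expr1 ('X - _)) dvdp_exp2l // ltnW.
have v1 : P1app f (Some 0) = Some 0.
  by apply/P1app_eqSome; rewrite /= scale0r subr0; apply: zero_of d1.
have v2 : P1app f (Some 1) = Some 1.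
  by apply/P1app_eqSome; rewrite /= scale1r; apply: zero_of d2.
have v3 : P1app f None = None.
  apply/P1app_eqNone => /=; apply: nth_default.
  have sDd : (size (den f) <= d)%N by move: sD h3; clear; lia.
  by rewrite degf.
have v4 : P1app f (Some mu) = Some lam.
  by apply/P1app_eqSome; apply: zero_of d4.
have nroot a e b : (b != a) -> root (('X - a%:P) ^+ e) b = false.
  by move=> ba; apply/negbTE/nroot_exp_XsubC.
have r1 : ram_index f (Some 0) = e1.
  apply/eqP; rewrite eqn_leq andbC; apply/andP; split.
    by apply: (ram_index_geq v1) => //; rewrite /fiber_poly scale0r (subr0 (num f)).
  apply: ram_index_wronsk => //; rewrite W dvdpZr // -mulrA dvdp_exp_XsubCM.
    by move: h1; clear; lia.
  by rewrite rootM !nroot // eq_sym ?oner_neq0.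
have r2 : ram_index f (Some 1) = e2.
  apply/eqP; rewrite eqn_leq andbC; apply/andP; split.
    by apply: (ram_index_geq v2) => //; rewrite /fiber_poly scale1r.
  apply: ram_index_wronsk => //.
  rewrite W dvdpZr // [X in X * _]mulrC -mulrA dvdp_exp_XsubCM.
    by move: h2; clear; lia.
  by rewrite rootM !nroot ?oner_neq0 // eq_sym.
have r3 : ram_index f None = e3.
  rewrite /ram_index v3 /= degf.
  have sD0 : (0 < size (den f))%N.
    by have := fiber_poly_neq0 None d0; rewrite -size_poly_gt0.
  have E : (d - (size (den f)).-1)%N = e3 by move: sD sD0; clear; lia.
  exact: E.
have r4 : ram_index f (Some mu) = e4.
  apply/eqP; rewrite eqn_leq andbC; apply/andP; split.
    by apply: (ram_index_geq v4).
  apply: ram_index_wronsk => //; rewrite W dvdpZr // mulrC dvdp_exp_XsubCM.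
    by move: h4; clear; lia.
  by rewrite rootM !nroot.
have unram y : ramified f y ->
    [\/ y = Some 0, y = Some 1, y = None | y = Some mu].
  case: y => [b|]; last by move=> _; constructor 3.
  case: (eqVneq b 0) => [->|b0]; first by constructor 1.
  case: (eqVneq b 1) => [->|b1]; first by constructor 2.
  case: (eqVneq b mu) => [->|bm]; first by constructor 4.
  rewrite /ramified ltnNge ram_index_wronsk // W dvdpZr // expr1 dvdp_XsubCl.
  by rewrite !rootM !nroot.
have ram1 : ramified f (Some 0) by rewrite /ramified r1.
have ram2 : ramified f (Some 1) by rewrite /ramified r2.
have ram3 : ramified f None by rewrite /ramified r3.
have ram4 : ramified f (Some mu) by rewrite /ramified r4.
have uniq_pt (z : P1 k) (w : P1 k) : ramified f z -> P1app f z = w ->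
    (forall y, ramified f y -> P1app f y = w -> y = z) ->
    unique (fun y => P1app f y = w /\ ramified f y) z.
  by move=> rz fz H; split=> // y [fy ry]; rewrite (H y).
have n01 : (1 : k) <> 0 by apply/eqP; rewrite oner_neq0.
have nl0 : lam <> 0 by apply/eqP.
have nl1 : lam <> 1 by apply/eqP.
split=> //; split=> //.
- split=> //.
    pose s := nseq e1.-1 0 ++ nseq e2.-1 1 ++ nseq e4.-1 mu.
    apply: (@separable_map_wronsk _ c s) => //.
    have prod_nseq a e : \prod_(b <- nseq e a) ('X - b%:P) = ('X - a%:P) ^+ e :> {poly k}.
      by rewrite big_nseq -Monoid.iteropE.
    by rewrite !big_cat /= !prod_nseq mulrA.
  move=> q; rewrite (pcharf_eq char_k) => /eqP -> y.
  have small e : (0 < e < p)%N -> ~~ (p %| e)%N.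
    by case/andP=> e0; apply: contraL; rewrite -leqNgt; apply: dvdn_leq.
  case: (ltnP 1 (ram_index f y)) => [/unram[] -> |le1].
  + by rewrite r1 small // ltnW.
  + by rewrite r2 small // ltnW.
  + by rewrite r3 small // ltnW.
  + by rewrite r4 small // ltnW.
  + by rewrite small // ram_index_gt0 // (leq_ltn_trans le1) // (ltn_trans h1).
- move=> x; rewrite !inE; split.
    by case=> y <- /unram[] ->; rewrite ?v1 ?v2 ?v3 ?v4 !eqxx ?orbT.
  case/or4P => /eqP ->;
    [exists (Some 0)|exists (Some 1)|exists None|exists (Some mu)] => //.
- case=> [[|[|[|[|//]]]] Hi];
    [exists (Some 0)|exists (Some 1)|exists None|exists (Some mu)];
    rewrite ?(tnth_nth (Some 0)) ?(tnth_nth 0%N) //=; apply: uniq_pt => // y /unram[] ->;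
    rewrite ?v1 ?v2 ?v3 ?v4 //; case => E; by [case: n01 | case: nl0 | case: nl1].
Qed.

End Criterion.
(** * The covers attached to a three-point cover *)

Section Cover.
Variables (k : closedFieldType) (p : nat).
Hypothesis char_k : p \in [pchar k].
Implicit Types (U P N D : {poly k}) (a c r mu lam : k).

(** The map [N / D]; only used when [N] and [D] are coprime, in which case the
   default value is irrelevant. *)
Definition fracmap N D : P1map k :=
  if coprimep N D =P true is ReflectT cop then MkP1map cop
  else MkP1map (coprimep1 (1 : {poly k})).

Lemma fracmapE N D : coprimep N D -> num (fracmap N D) = N /\ den (fracmap N D) = D.
Proof. by rewrite /fracmap; case: eqP. Qed.

(** The combination of [P] and [U] proportional to [P - g mu * U], for
   [g = P / U], when [lam_poly] vanishes at [mu] and [lam] is not [mu ^ p]. *)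
Definition pencil U P lam mu : {poly k} :=
  (lam - mu ^+ p) *: P + ((1 - lam) * mu ^+ p) *: U.

(** Numerator and denominator of the cover attached to [mu]. *)
Definition cover_den U P lam mu : {poly k} := pencil U P lam mu %/ ('X - mu%:P).

Definition cover_num U P lam mu : {poly k} :=
  lam *: cover_den U P lam mu + (lam * (1 - lam)) *: (('X - mu%:P) ^+ p.-1 * U).

(** With [g = P / U] normalized by [g 0 = 0] and [g 1 = 1], this is the map
   [lam + a * (z ^ p - mu ^ p) / (g - g mu)], where [a] is such that 0 and 1 are
   fixed. *)
Definition pencil_cover U P lam mu : P1map k :=
  fracmap (cover_num U P lam mu) (cover_den U P lam mu).

Lemma cover_denK U P lam mu : root (lam_poly p U P lam) mu ->
  ('X - mu%:P) * cover_den U P lam mu = pencil U P lam mu.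
Proof.
move=> r; rewrite mulrC divpK // dvdp_XsubCl rootE /pencil !hornerE.
by rewrite -horner_lam_poly.
Qed.

Lemma exp_pred_charM a F : ('X - a%:P) * (('X - a%:P) ^+ p.-1 * F) =
  ('X ^+ p - (a ^+ p)%:P) * F :> {poly k}.
Proof. by rewrite mulrA -exprS (pred_charK char_k) (exp_XsubC_pchar char_k). Qed.

Variables (m n e1 e2 e3 : nat) (U P : {poly k}) (lam mu : k).
Hypotheses (l0 : lam != 0) (l1 : lam != 1) (m0 : mu != 0) (m1 : mu != 1).
Hypotheses (UP : exact_pade m n e1 e2 U P) (lt_mn : (m < n)%N).
Hypotheses (rmu : root (lam_poly p U P lam) mu) (lmu : lam != mu ^+ p).
Hypotheses (h1 : (1 < e1 < p)%N) (h2 : (1 < e2 < p)%N) (h3 : (1 < e3 < p)%N).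
Hypotheses (podd : (2 < p)%N) (hn : (n + e3 = p + m)%N).

Let N := cover_num U P lam mu.
Let D := cover_den U P lam mu.
Let kap := lam * (1 - lam).

Let l1' : 1 - lam != 0. Proof. by rewrite subr_eq0 eq_sym. Qed.
Let kap0 : kap != 0. Proof. by rewrite mulf_neq0. Qed.
Let lmu' : lam - mu ^+ p != 0. Proof. by rewrite subr_eq0. Qed.
Let DK : ('X - mu%:P) * D = pencil U P lam mu. Proof. exact: cover_denK. Qed.

Lemma cover_num0 : ('X - mu%:P) * N =
  lam *: ((lam - mu ^+ p) *: P + (1 - lam) *: ('X ^+ p * U)).
Proof.
rewrite /N /cover_num mulrDr -!scalerAr DK exp_pred_charM /pencil.
rewrite -!mul_polyC !(polyCM, polyCB, polyCN); ring.
Qed.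

Lemma cover_num1 : ('X - mu%:P) * (N - D) =
  (1 - lam) *: ((lam - mu ^+ p) *: (U - P) + lam *: (('X ^+ p - 1) * U)).
Proof.
rewrite mulrBr cover_num0 DK /pencil.
rewrite -!mul_polyC !(polyCM, polyCB, polyCN) polyC1; ring.
Qed.

Lemma dvdp_cover0 : ('X - 0%:P) ^+ e1 %| N.
Proof.
have [[_ _ dP _] _ _ _ _] := UP; have /andP[_ h1p] := h1.
have : ('X - 0%:P) ^+ e1 %| ('X - mu%:P) * N.
  rewrite cover_num0 dvdpZr // dvdp_add // dvdpZr // dvdp_mulr //.
  have -> : 'X ^+ p = ('X - 0%:P) ^+ p :> {poly k} by rewrite subr0.
  by rewrite dvdp_exp2l // ltnW.
by rewrite Gauss_dvdpr // coprimep_expl // coprimep_XsubC root_XsubC.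
Qed.

Lemma dvdp_cover1 : ('X - 1%:P) ^+ e2 %| N - D.
Proof.
have [[_ _ _ dUP] _ _ _ _] := UP; have /andP[_ h2p] := h2.
have : ('X - 1%:P) ^+ e2 %| ('X - mu%:P) * (N - D).
  rewrite cover_num1 dvdpZr // dvdp_add // ?dvdpZr // dvdp_mulr //.
  have -> : 'X ^+ p - 1 = ('X - 1%:P) ^+ p :> {poly k}.
    by rewrite (exp_XsubC_pchar char_k) expr1n.
  by rewrite dvdp_exp2l // ltnW.
by rewrite Gauss_dvdpr // coprimep_expl // coprimep_XsubC root_XsubC.
Qed.

Lemma cover_fiber_lam : N - lam *: D = kap *: (('X - mu%:P) ^+ p.-1 * U).
Proof. by rewrite /N /cover_num -/D addrC addKr. Qed.

Lemma size_cover_den : size D = n.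
Proof.
have [_ sU sP _ _] := UP.
have sG : size (pencil U P lam mu) = n.+1.
  rewrite /pencil size_polyDl (size_scale P lmu') // sP.
  by apply: leq_ltn_trans (size_scale_leq _ _) _; rewrite sU ltnS.
have D0 : D != 0.
  by apply: contra_eq_neq sG => D0; rewrite -DK D0 mulr0 size_poly0.
by have := sG; rewrite -DK size_monicM ?monicXsubC // size_XsubC => -[].
Qed.

Lemma size_cover_num : size N = (p + m)%N.
Proof.
have [_ sU _ _ _] := UP.
have U0 : U != 0 by rewrite -size_poly_gt0 sU.
have s : size (kap *: (('X - mu%:P) ^+ p.-1 * U)) = (p + m)%N.
  rewrite size_scale // size_monicM ?monic_exp ?monicXsubC // size_exp_XsubC.
  by rewrite (pred_charK char_k) sU addnS.
have -> : N = kap *: (('X - mu%:P) ^+ p.-1 * U) + lam *: D.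
  by rewrite -cover_fiber_lam subrK.
rewrite size_polyDl s // size_scale // size_cover_den -hn -addn1 leq_add2l.
by case/andP: h3 => /ltnW.
Qed.

Lemma cover_wronsk : exists2 c, c != 0 & wronsk N D =
  c *: (('X - 0%:P) ^+ e1.-1 * ('X - 1%:P) ^+ e2.-1 * ('X - mu%:P) ^+ p.-1.-1).
Proof.
have [_ _ _ _ [c c0 W]] := UP.
exists (kap * (lam - mu ^+ p) * c); first by rewrite !mulf_neq0.
have Xmu0 : ('X - mu%:P) ^+ 2 != 0 :> {poly k} by rewrite expf_neq0 ?polyXsubC_eq0.
apply: (mulfI Xmu0); rewrite -(wronsk_subZl N D lam) cover_fiber_lam -wronskMM DK.
rewrite -scalerAr exp_pred_charM.
have WE : wronsk (kap *: (('X ^+ p - (mu ^+ p)%:P) * U)) (pencil U P lam mu) =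
    (kap * (lam - mu ^+ p)) *: (('X ^+ p - (mu ^+ p)%:P) * wronsk U P).
  have dE : ((('X ^+ p - (mu ^+ p)%:P) * U))^`() = ('X ^+ p - (mu ^+ p)%:P) * U^`().
    by rewrite mulrBl derivB deriv_mulC (deriv_Xp_mul char_k) -mulrBl.
  rewrite /wronsk /pencil derivZ dE derivD !derivZ.
  rewrite -!mul_polyC !(polyCM, polyCB, polyCN); ring.
rewrite WE W -(exp_XsubC_pchar char_k).
have pE : p = p.-1.-1.+2 by move: podd; clear; lia.
rewrite {2}pE 2!exprS expr2 -!mul_polyC !polyCM; ring.
Qed.

Lemma cover_coprime : coprimep N D.
Proof.
have [_ _ _ cop [c c0 W]] := UP; have [c' c'0 W'] := cover_wronsk.
apply/Pdiv.ClosedField.coprimepP => r rN; apply/negP => rD.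
have Fr : root (kap *: (('X - mu%:P) ^+ p.-1 * U)) r.
  by rewrite -cover_fiber_lam rootE hornerD hornerN hornerZ (eqP rN) (eqP rD) mulr0 subrr.
case: (eqVneq r mu) => [rE|rmu'].
  (* a zero of [D] at [mu] would make the Wronskian vanish too much there *)
  have : ('X - mu%:P) ^+ p.-1 %| wronsk (N - lam *: D) D.
    apply: dvdp_wronsk_root; last by rewrite -rE.
    by rewrite cover_fiber_lam dvdpZr // dvdp_mulr.
  rewrite wronsk_subZl W' dvdpZr // mulrC dvdp_exp_XsubCM.
    by move: podd; clear; lia.
  by rewrite rootM negb_or !nroot_exp_XsubC.
move: Fr; rewrite rootZ // rootM (negPf (nroot_exp_XsubC _ rmu')) /= => rU.
have : root (pencil U P lam mu) r by rewrite -DK rootM [root D r]rD orbT.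
rewrite rootE /pencil hornerD !hornerZ (eqP rU) mulr0 addr0 mulf_eq0 (negPf lmu') /=.
by apply/negP; apply: coprimep_root cop rU.
Qed.

Lemma cover_numE : num (pencil_cover U P lam mu) = N.
Proof. by have [] := fracmapE cover_coprime. Qed.

Lemma cover_denE : den (pencil_cover U P lam mu) = D.
Proof. by have [] := fracmapE cover_coprime. Qed.

Lemma cover_ramification :
  has_ramification_type lam (p.-1 + m) [tuple e1; e2; e3; p.-1]
    (pencil_cover U P lam mu) /\
  [/\ ram_pt (pencil_cover U P lam mu) (Some 0) (Some 0),
      ram_pt (pencil_cover U P lam mu) (Some 1) (Some 1),
      ram_pt (pencil_cover U P lam mu) None None
    & ram_pt (pencil_cover U P lam mu) (Some mu) (Some lam)].
Proof.
have [c c0 W] := cover_wronsk.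
have pK := pred_charK char_k.
apply: (ramification_criterion char_k (mu := mu) (c := c));
  rewrite ?cover_numE ?cover_denE //.
- by move: podd; clear; lia.
- by rewrite size_cover_num -addSn pK.
- by rewrite size_cover_den hn -addSn pK.
- exact: dvdp_cover0.
- exact: dvdp_cover1.
- by rewrite cover_fiber_lam dvdpZr // dvdp_mulr.
Qed.

End Cover.
Section Converse.
Variables (k : closedFieldType) (p : nat).
Hypothesis char_k : p \in [pchar k].
Implicit Types (U P N D : {poly k}) (f g : P1map k) (a c r mu lam : k).

(** Any fraction [N / D] with the prescribed multiplicities at 0, 1, infinity and [mu],
   less than [p] at 0, comes from a solution of the Padé problem; the inequalities
   [n < p], [e1 <= n] and [e2 <= n] are necessary. *)
Lemma cover_pade N D lam mu d e1 e2 e3 :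
    lam != 0 -> lam != 1 -> mu != 0 -> mu != 1 ->
    (0 < e1 < p)%N -> (e2 <= p)%N -> (0 < e3 < p)%N ->
    (e1 + e2 + e3 + p = d.*2 + 3)%N ->
    coprimep N D -> D != 0 -> size N = d.+1 -> (size D + e3 <= d.+1)%N ->
    ('X - 0%:P) ^+ e1 %| N -> ~~ (('X - 0%:P) ^+ p %| N) ->
    ('X - 1%:P) ^+ e2 %| N - D -> ('X - mu%:P) ^+ p.-1 %| N - lam *: D ->
  exists m n, [/\ (p + m = d.+1)%N, (n + e3 = d.+1)%N, (n < p)%N &
    (e1 <= n)%N /\ (e2 <= n)%N /\ lam != mu ^+ p /\
    exists U P, [/\ pade m n e1 e2 U P, size U = m.+1,
      ('X - mu%:P) * D = pencil p U P lam mu &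
      N - lam *: D = (lam * (1 - lam)) *: (('X - mu%:P) ^+ p.-1 * U)]].
Proof.
move=> l0 l1 m0 m1 /andP[h1 h1p] h2p /andP[h3 h3p] sumE cop D0 sN sD d1 nd1 d2 d4.
have l1' : 1 - lam != 0 by rewrite subr_eq0 eq_sym.
set kap := lam * (1 - lam); have kap0 : kap != 0 by rewrite mulf_neq0.
have pK := pred_charK char_k.
have sND : size (N - lam *: D) = d.+1.
  rewrite size_polyDl sN // size_polyN size_scale // ltnS -(leq_add2r e3).
  by apply: leq_trans sD _; rewrite -addn1 leq_add2l.
have ND0 : N - lam *: D != 0 by rewrite -size_poly_gt0 sND.
have le_pd : (p <= d.+1)%N.
  by have := dvdp_leq ND0 d4; rewrite size_exp_XsubC pK sND.
have le_ed : (e3 <= d.+1)%N by apply: leq_trans sD; rewrite leq_addl.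
pose m := (d.+1 - p)%N; pose n := (d.+1 - e3)%N.
have mE : (p + m = d.+1)%N by rewrite subnKC.
have nE : (n + e3 = d.+1)%N by rewrite subnK.
have lt_mn : (m < n)%N by move: mE nE h3p; clear; lia.
have mnE : (m + n + 1 = e1 + e2)%N by move: mE nE sumE; clear; lia.
have sDn : (size D <= n)%N by rewrite -(leq_add2r e3) nE.
have [U' UE'] : exists U', N - lam *: D = ('X - mu%:P) ^+ p.-1 * U'.
  by have /dvdpP[U' ->] := d4; exists U'; rewrite mulrC.
pose U := kap^-1 *: U'.
have UE : N - lam *: D = kap *: (('X - mu%:P) ^+ p.-1 * U).
  by rewrite /U -scalerAr scalerA divff // scale1r.
have U0 : U != 0.
  by apply: contraNneq ND0 => U0; rewrite UE U0 mulr0 scaler0.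
clearbody U => {U' UE'}.
have sU : size U = m.+1.
  have := sND; rewrite UE size_scale // size_monicM ?monic_exp ?monicXsubC //.
  by rewrite size_exp_XsubC pK => E; apply/eqP; rewrite -(eqn_add2l p) addnS mE -E
    prednK // addn_gt0 -pK.
pose Q := ('X - mu%:P) * D - ((1 - lam) * mu ^+ p) *: U.
(* otherwise [D] is constant and [N] is a multiple of [X ^ p] *)
have indep c : ('X - mu%:P) * D = c *: U -> False.
  move=> E; have c0 : c != 0.
    apply: contraTneq isT => c0; move: E; rewrite c0 scale0r => /eqP.
    by rewrite mulf_eq0 polyXsubC_eq0 (negPf D0).
  have UD : U = c^-1 *: (('X - mu%:P) * D) by rewrite E scalerA mulVf // scale1r.
  have NE : N = lam *: D + (kap * c^-1) *: (('X ^+ p - (mu ^+ p)%:P) * D).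
    have -> : N = lam *: D + (N - lam *: D) by rewrite addrC subrK.
    rewrite UE UD -scalerAr scalerA mulrA -exprSr pK.
    by rewrite (exp_XsubC_pchar char_k).
  have /size_poly1P[dl dl0 DE] : size D == 1%N.
    rewrite size_poly_eq1; apply: (coprimepP _ _ cop) => //.
    rewrite NE dvdp_add //; first by rewrite -mul_polyC dvdp_mull.
    by rewrite -mul_polyC !dvdp_mull.
  case/negP: nd1; have : root N 0.
    rewrite -dvdp_XsubCl; apply: dvdp_trans d1.
    by rewrite -{1}(expr1 ('X - _)) dvdp_exp2l.
  rewrite NE DE rootE !hornerE expr0n -[in (p == 0)%N]pK /= => /eqP E0.
  have -> : lam *: dl%:P + (kap / c) *: (('X^p - (mu ^+ p)%:P) * dl%:P) =
     (kap / c * dl) *: 'X^p + (lam * dl + kap / c * ((0 - mu ^+ p) * dl))%:P.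
    rewrite -!mul_polyC !(polyCM, polyCB, polyCN, polyCD, polyC0); ring.
  have -> : lam * dl + kap / c * ((0 - mu ^+ p) * dl) = 0.
    by rewrite -[RHS]E0; ring.
  by rewrite addr0 -mul_polyC dvdp_mull // subr0.
have NQ : ('X - mu%:P) * N = lam *: (Q + (1 - lam) *: ('X ^+ p * U)).
  have -> : N = lam *: D + (N - lam *: D) by rewrite addrC subrK.
  rewrite UE mulrDr -!scalerAr exp_pred_charM // /Q /kap.
  rewrite -!mul_polyC !(polyCM, polyCB, polyCN); ring.
have NDQ : ('X - mu%:P) * (N - D) =
    (lam - 1) *: (Q - (lam - mu ^+ p) *: U - lam *: (('X ^+ p - 1) * U)).
  rewrite mulrBr NQ /Q.
  rewrite -!mul_polyC !(polyCM, polyCB, polyCN) polyC1; ring.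
have dQ : ('X - 0%:P) ^+ e1 %| Q.
  have : ('X - 0%:P) ^+ e1 %| ('X - mu%:P) * N by rewrite dvdp_mull.
  rewrite NQ dvdpZr // dvdp_addl // dvdpZr // dvdp_mulr //.
  have -> : 'X ^+ p = ('X - 0%:P) ^+ p :> {poly k} by rewrite subr0.
  by rewrite dvdp_exp2l // ltnW.
have dQU : ('X - 1%:P) ^+ e2 %| Q - (lam - mu ^+ p) *: U.
  have : ('X - 1%:P) ^+ e2 %| ('X - mu%:P) * (N - D) by rewrite dvdp_mull.
  rewrite NDQ dvdpZr ?subr_eq0 // dvdp_subl // dvdpZr // dvdp_mulr //.
  have -> : 'X ^+ p - 1 = ('X - 1%:P) ^+ p :> {poly k}.
    by rewrite (exp_XsubC_pchar char_k) expr1n.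
  by rewrite dvdp_exp2l.
have sQ : (size Q <= n.+1)%N.
  apply: leq_trans (size_polyD _ _) _; rewrite size_polyN geq_max; apply/andP; split.
    by rewrite size_monicM ?monicXsubC // size_XsubC.
  by apply: leq_trans (size_scale_leq _ _) _; rewrite sU ltnW.
have size_dvd (q : {poly k}) (i j : nat) : q != 0 ->
    ('X - 0%:P) ^+ i %| q -> ('X - 1%:P) ^+ j %| q ->
    (i + j < size q)%N.
  move=> q0 di dj; have := dvdp_coprime_exp _ di dj.
  rewrite eq_sym oner_neq0 => /(_ isT)/(dvdp_leq q0).
  rewrite size_Mmonic ?monic_exp ?monicXsubC ?expf_neq0 ?polyXsubC_eq0 //.
  by rewrite !size_exp_XsubC addnS.
have Qindep c : Q - c *: U != 0.
  apply/negP => /eqP Q0; apply: (@indep (c + (1 - lam) * mu ^+ p)).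
  apply/eqP; rewrite -subr_eq0 -[X in _ == X]Q0 /Q scalerDl opprD addrA.
  by rewrite addrAC.
have Q0 : Q != 0 by have := Qindep 0; rewrite scale0r subr0.
have lmu : lam != mu ^+ p.
  apply/negP => /eqP E; rewrite E subrr scale0r subr0 in dQU.
  by have := leq_trans (size_dvd _ _ _ Q0 dQ dQU) sQ; move: mnE; clear; lia.
have lmu' : lam - mu ^+ p != 0 by rewrite subr_eq0.
pose P := (lam - mu ^+ p)^-1 *: Q.
have PE : (lam - mu ^+ p) *: P = Q by rewrite scalerA divff // scale1r.
have P0 : P != 0 by rewrite scaler_eq0 invr_eq0 (negPf lmu').
have UPE : U - P = - (lam - mu ^+ p)^-1 *: (Q - (lam - mu ^+ p) *: U).
  by rewrite scaleNr scalerBr scalerA mulVf // scale1r opprB.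
have UP0 : U - P != 0 by rewrite UPE scaler_eq0 oppr_eq0 invr_eq0 (negPf lmu') /= Qindep.
have dP : ('X - 0%:P) ^+ e1 %| P by rewrite dvdpZr ?invr_eq0.
have dUP : ('X - 1%:P) ^+ e2 %| U - P by rewrite UPE dvdpZr ?oppr_eq0 ?invr_eq0.
have sP : (size P <= n.+1)%N by apply: leq_trans (size_scale_leq _ _) _.
have sUP : (size (U - P)%R <= n.+1)%N.
  by apply: leq_trans (size_polyD _ _) _; rewrite size_polyN geq_max sP sU ltnS ltnW.
exists m, n; split=> //; last split; last split; last split => //.
- (* [X ^ p * U - P] vanishes to order [e1] at 0 and [e2] at 1 *)
  pose S := 'X ^+ p * U - P.
  have sXU : size ('X ^+ p * U) = (p + m.+1)%N.
    by rewrite size_monicM ?monicXn // size_polyXn sU.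
  have lt_S : (size P < size ('X ^+ p * U)%R)%N.
    by rewrite sXU; apply: leq_ltn_trans sP _; move: mE nE h3; clear; lia.
  have sS : size S = (p + m.+1)%N by rewrite size_polyDl ?size_polyN.
  have S0 : S != 0 by rewrite -size_poly_gt0 sS addnS.
  have dS0 : ('X - 0%:P) ^+ e1 %| S.
    rewrite dvdp_sub // dvdp_mulr //.
    have -> : 'X ^+ p = ('X - 0%:P) ^+ p :> {poly k} by rewrite subr0.
    by rewrite dvdp_exp2l // ltnW.
  have dS1 : ('X - 1%:P) ^+ e2 %| S.
    have -> : S = ('X - 1%:P) ^+ p * U + (U - P).
      by rewrite (exp_XsubC_pchar char_k) expr1n /S; ring.
    by rewrite dvdp_add // dvdp_mulr // dvdp_exp2l.
  by have := size_dvd _ _ _ S0 dS0 dS1; rewrite sS; move: mnE; clear; lia.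
- by have := dvdp_leq P0 dP; rewrite size_exp_XsubC => /leq_trans/(_ sP).
- by have := dvdp_leq UP0 dUP; rewrite size_exp_XsubC => /leq_trans/(_ sUP).
- exists U, P; split=> //; first by split; rewrite ?sU.
  by rewrite /pencil PE /Q subrK.
Qed.

(** By uniqueness of the Padé solution, such a fraction is the cover attached to
   [mu], up to a common factor. *)
Lemma cover_complete f U P lam mu m n e1 e2 U1 P1 :
    lam != 0 -> lam != 1 -> lam != mu ^+ p -> (m + n + 1 = e1 + e2)%N ->
    exact_pade m n e1 e2 U P -> pade m n e1 e2 U1 P1 -> size U1 = m.+1 ->
    ('X - mu%:P) * den f = pencil p U1 P1 lam mu ->
    num f - lam *: den f = (lam * (1 - lam)) *: (('X - mu%:P) ^+ p.-1 * U1) ->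
  root (lam_poly p U P lam) mu /\ exists2 c, c != 0 &
    num f = c *: cover_num p U P lam mu /\ den f = c *: cover_den p U P lam mu.
Proof.
move=> l0 l1 lmu mnE [pUP sU sP cop _] pUP1 sU1 ED EN.
have cross := pade_unique mnE pUP pUP1.
have U10 : U1 != 0 by rewrite -size_poly_gt0 sU1.
have U0 : U != 0 by rewrite -size_poly_gt0 sU.
have : U %= U1.
  rewrite -dvdp_size_eqp ?sU ?sU1 //.
  by rewrite -(Gauss_dvdpl _ cop) cross dvdp_mull.
case/eqpP => -[a b] /= /andP[a0 b0] abE.
pose c := a / b; have c0 : c != 0 by rewrite mulf_neq0 ?invr_eq0.
have U1E : U1 = c *: U by rewrite /c mulrC -scalerA abE scalerA mulVf // scale1r.
have P1E : P1 = c *: P.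
  by apply: (mulIf U0); rewrite -cross U1E -!scalerAl mulrC.
have ED' : ('X - mu%:P) * den f = c *: pencil p U P lam mu.
  rewrite ED U1E P1E /pencil -!mul_polyC; ring.
have rmu : root (lam_poly p U P lam) mu.
  have : (c *: pencil p U P lam mu).[mu] = 0.
    by rewrite -ED' hornerM hornerXsubC subrr mul0r.
  rewrite hornerZ => /eqP; rewrite mulf_eq0 (negPf c0) /= rootE horner_lam_poly.
  by rewrite /pencil hornerD !hornerZ.
split=> //; exists c => //.
have DE : den f = c *: cover_den p U P lam mu.
  have X0 : 'X - mu%:P != 0 by rewrite polyXsubC_eq0.
  by apply: (mulfI X0); rewrite ED' -scalerAr cover_denK.
split=> //.
have -> : num f = lam *: den f + (num f - lam *: den f) by rewrite addrC subrK.
rewrite EN DE U1E /cover_num -!mul_polyC; ring.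
Qed.

End Converse.
(** * Normalizing the ramified points *)

Section Moebius.
Variable k : closedFieldType.
Implicit Types (f g i : P1map k) (x y z : P1 k) (a b c d u v : k).

Lemma hval1 (F : {poly k}) u v : hval 1 F u v = F`_1 * u + F`_0 * v.
Proof.
rewrite /hval big_ord_recl big_ord1 /= /bump /=.
by rewrite !expr0 !expr1 mul1r mulr1 addrC.
Qed.

Lemma moebius_coprime a b c d : a * d - b * c != 0 ->
  coprimep (a *: 'X + b%:P) (c *: 'X + d%:P).
Proof.
move=> det; apply/Pdiv.ClosedField.coprimepP => r /rootP.
rewrite !hornerE => E1; apply: contra_neq det => E2.
have -> : a * d - b * c = a * (c * r + d) - c * (a * r + b) by ring.
by rewrite E1 E2 !mulr0 subrr.
Qed.

(** The map [z |-> (a z + b) / (c z + d)]. *)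
Definition moebius a b c d (det : a * d - b * c != 0) : P1map k :=
  MkP1map (moebius_coprime det).

Lemma P1app_moebius a b c d (det : a * d - b * c != 0) u v :
  (u != 0) || (v != 0) ->
  P1app (moebius det) (pt u v) = pt (a * u + b * v) (c * u + d * v).
Proof.
move=> uv; have coef1 s t : (s *: 'X + t%:P : {poly k})`_1 = s.
  by rewrite coefD coefZ coefX coefC /= mulr1 addr0.
have coef0' s t : (s *: 'X + t%:P : {poly k})`_0 = t.
  by rewrite coefD coefZ coefX coefC /= mulr0 add0r.
have deg : degree (moebius det) = 1%N.
  have sle s t : (size (s *: 'X + t%:P : {poly k})%R <= 2)%N.
    apply: leq_trans (size_polyD _ _) _; rewrite geq_max size_polyC.
    by rewrite (leq_trans (size_scale_leq _ _)) ?size_polyX //; case: eqP.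
  have sge (F : {poly k}) : F`_1 != 0 -> (1 < size F)%N.
    by rewrite ltnNge; apply: contraNN => /(nth_default 0) ->.
  have mle : (maxn (size (num (moebius det))) (size (den (moebius det))) <= 2)%N.
    by rewrite geq_max !sle.
  have mge : (1 < maxn (size (num (moebius det))) (size (den (moebius det))))%N.
    have : (a != 0) || (c != 0).
      rewrite -negb_and; move: (det); apply: contra => /andP[/eqP-> /eqP->].
      by rewrite mul0r mulr0 subrr.
    by rewrite leq_max => /orP[] h; apply/orP; [left|right]; apply: sge; rewrite coef1.
  rewrite /degree; apply/eqP; rewrite eqn_leq.
  by move: mle mge; case: (maxn _ _) => [|[|[|]]].
by rewrite P1app_pt // deg !hval1 /= !coef1 !coef0'.
Qed.

Lemma moebius_iso a b c d (det : a * d - b * c != 0) : P1iso (moebius det).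
Proof.
have det' : d * a - (- b) * (- c) != 0 by rewrite mulrNN mulrC.
have neq0 s t s' t' u v : s * t' - t * s' != 0 -> (u != 0) || (v != 0) ->
    (s * u + t * v != 0) || (s' * u + t' * v != 0).
  move=> D; rewrite -!negb_and; apply: contra => /andP[/eqP E1 /eqP E2].
  have : (s * t' - t * s') * u = 0.
    have -> : (s * t' - t * s') * u = t' * (s * u + t * v) - t * (s' * u + t' * v) by ring.
    by rewrite E1 E2 !mulr0 subrr.
  have : (s * t' - t * s') * v = 0.
    have -> : (s * t' - t * s') * v = s * (s' * u + t' * v) - s' * (s * u + t * v) by ring.
    by rewrite E1 E2 !mulr0 subrr.
  by move=> /eqP + /eqP; rewrite !mulf_eq0 (negPf D) /= => -> ->.
exists (moebius det'); split=> y; rewrite -(pt_rep y);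
  rewrite !P1app_moebius ?neq0 ?rep_neq0 //.
  by rewrite -[RHS](ptZ _ _ det); congr (pt _ _); ring.
by rewrite -[RHS](ptZ _ _ det); congr (pt _ _); ring.
Qed.

(** The determinant of the homogeneous coordinates of two points. *)
Definition coord_det (y z : P1 k) : k := (rep y).1 * (rep z).2 - (rep z).1 * (rep y).2.

Lemma coord_det_neq0 y z : y <> z -> coord_det y z != 0.
Proof.
rewrite /coord_det; case: y z => [b|] [b'|] //= H;
  rewrite ?mulr1 ?mulr0 ?mul1r ?sub0r ?subr0 ?oppr_eq0 ?oner_neq0 //.
by rewrite subr_eq0; apply/eqP => E; apply: H; rewrite E.
Qed.

(** The automorphisms of the projective line act transitively on triples of
   distinct points. *)
Lemma P1iso_3trans y1 y2 y3 : y1 <> y2 -> y1 <> y3 -> y2 <> y3 ->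
  exists i, [/\ P1iso i, P1app i (Some 0) = y1, P1app i (Some 1) = y2
              & P1app i None = y3].
Proof.
move=> n12 n13 n23.
pose al := coord_det y2 y1; pose be := coord_det y3 y2; pose ga := coord_det y3 y1.
have al0 : al != 0 by apply: coord_det_neq0 => /esym.
have be0 : be != 0 by apply: coord_det_neq0 => /esym.
have ga0 : ga != 0 by apply: coord_det_neq0 => /esym.
have det : (al * (rep y3).1) * (be * (rep y1).2) - (be * (rep y1).1) * (al * (rep y3).2) != 0.
  have -> : (al * (rep y3).1) * (be * (rep y1).2) - (be * (rep y1).1) * (al * (rep y3).2)
    = al * be * ga by rewrite /ga /coord_det; ring.
  by rewrite !mulf_neq0.
have p0 : Some 0 = pt 0 1 :> P1 k by rewrite /pt oner_eq0 mul0r.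
have p1 : Some 1 = pt 1 1 :> P1 k by rewrite /pt oner_eq0 divr1.
have poo : None = pt 1 0 :> P1 k by rewrite /pt eqxx.
exists (moebius det); split; first exact: moebius_iso.
- by rewrite p0 P1app_moebius ?oner_neq0 ?orbT // !mulr0 !add0r !mulr1 ptZ // pt_rep.
- rewrite p1 P1app_moebius ?oner_neq0 // !mulr1 -[RHS]pt_rep -[RHS](ptZ _ _ ga0).
  by congr (pt _ _); rewrite /ga /al /be /coord_det; ring.
- by rewrite poo P1app_moebius ?oner_neq0 // !mulr0 !addr0 !mulr1 ptZ // pt_rep.
Qed.

(** An automorphism fixing 0, 1 and infinity is the identity. *)
Lemma P1iso_fix3 i y : P1iso i -> P1app i (Some 0) = Some 0 ->
  P1app i (Some 1) = Some 1 -> P1app i None = None -> P1app i y = y.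
Proof.
move=> /P1iso_degree deg i0 i1 ioo.
rewrite P1appE deg !hval1 /=.
have d1 : (den i)`_1 = 0 by move/P1app_eqNone: ioo; rewrite deg.
have n0 : (num i)`_0 = 0.
  by move/P1app_eqSome: i0; rewrite rootE /= scale0r subr0 horner_coef0 => /eqP.
have n1 : (num i)`_1 = (den i)`_0.
  move/P1app_eqSome: i1; rewrite rootE /= scale1r hornerD hornerN.
  have s (F : {poly k}) : (size F <= 2)%N -> F.[1] = F`_1 + F`_0.
    move=> sF; rewrite (horner_coef_wide _ sF) big_ord_recl big_ord1 /= /bump /=.
    by rewrite !expr1n !mulr1 addrC.
  have := size_num i; have := size_den i; rewrite deg => sd sn.
  by rewrite !s // n0 d1 addr0 add0r subr_eq0 => /eqP.
rewrite d1 n0 n1 !mul0r addr0 add0r ptZ ?pt_rep //.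
by have := top_coef_neq0 i; rewrite deg d1 eqxx orbF n1.
Qed.

End Moebius.
(** * Counting isomorphism classes *)

Section Counting.
Variables (k : closedFieldType) (p : nat).
Hypothesis char_k : p \in [pchar k].
Implicit Types (f g i : P1map k) (U P : {poly k}) (lam mu : k).

Lemma ram_index_iso_comp f i y : P1iso i -> (0 < degree f)%N ->
  ram_index (P1comp f i) y = ram_index f (P1app i y).
Proof.
move=> Hi d0; rewrite (@ram_index_iso _ (P1comp f i) f i y Hi) // => [z|].
  by rewrite P1app_comp.
by rewrite degree_comp (P1iso_degree Hi) muln1.
Qed.

(** A cover can be reparametrized so that its ramified points over 0, 1 and
   infinity are these points themselves; [mu] is then the one over [lam]. *)
Lemma normalize f lam d e1 e2 e3 e4 : lam != 0 -> lam != 1 ->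
    (0 < e3)%N -> has_ramification_type lam d [tuple e1; e2; e3; e4] f ->
  exists i mu, let g := P1comp f i in
  [/\ P1iso i, mu != 0, mu != 1 &
    [/\ size (num g) = d.+1, (size (den g) + e3 = d.+1)%N, den g != 0 &
    [/\ ('X - 0%:P) ^+ e1 %| num g, ~~ (('X - 0%:P) ^+ e1.+1 %| num g),
      ('X - 1%:P) ^+ e2 %| num g - den g &
      ('X - mu%:P) ^+ e4 %| num g - lam *: den g]]].
Proof.
move=> l0 l1 h3 [[d0 _ _] degf _ Hr].
have [y1 [[f1 _] _]] := Hr (inord 0).
have [y2 [[f2 _] _]] := Hr (inord 1).
have [y3 [[f3 _] _]] := Hr (inord 2).
have [y4 [[f4 _] _]] := Hr (inord 3).
rewrite (tnth_nth (Some 0)) inordK //= in f1.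
rewrite (tnth_nth (Some 0)) inordK //= in f2.
rewrite (tnth_nth (Some 0)) inordK //= in f3.
rewrite (tnth_nth (Some 0)) inordK //= in f4.
rewrite (tnth_nth 0%N) inordK //= => r4.
rewrite (tnth_nth 0%N) inordK //= => r3.
rewrite (tnth_nth 0%N) inordK //= => r2.
rewrite (tnth_nth 0%N) inordK //= => r1.
have diff y z (a b : P1 k) : P1app f y = a -> P1app f z = b -> a <> b -> y <> z.
  by move=> <- <- H E; apply: H; rewrite E.
have n01 : Some 0 <> Some 1 :> P1 k by case=> /esym/eqP; rewrite oner_eq0.
have [|||i [Hi i1 i2 i3]] := @P1iso_3trans k y1 y2 y3.
- exact: diff f1 f2 n01.
- by apply: diff f1 f3 _.
- by apply: diff f2 f3 _.
have [j [ijK jiK]] := Hi.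
have ne4 y z : P1app f y = z -> z <> Some lam -> P1app j y4 <> P1app j y.
  by move=> fy nz E; apply: nz; rewrite -fy -f4 -(jiK y4) E jiK.
case Emu: (P1app j y4) => [mu|]; last first.
  by case: (ne4 y3 None f3) => //; rewrite Emu -i3 ijK.
have imu : P1app i (Some mu) = y4 by rewrite -Emu jiK.
exists i, mu; set g := P1comp f i.
have degg : degree g = d by rewrite degree_comp (P1iso_degree Hi) muln1.
have dg0 : (0 < degree g)%N by rewrite degg -degf.
have ramg y : ram_index g y = ram_index f (P1app i y) by apply: ram_index_iso_comp.
have dvdg b a e : P1app f (P1app i (Some b)) = Some a ->
    (ram_index f (P1app i (Some b)) = e)%N ->
    ('X - b%:P) ^+ e %| fiber_poly g (Some a) /\
    ~~ (('X - b%:P) ^+ e.+1 %| fiber_poly g (Some a)).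
  move=> fb <-; rewrite -ramg /ram_index P1app_comp fb.
  by rewrite -mup_geq ?leqnn -?mup_leq ?leqnn ?fiber_poly_neq0.
have [dv1 ndv1] := dvdg 0 0 e1 (etrans (congr1 _ i1) f1) (etrans (congr1 _ i1) r1).
have [dv2 _] := dvdg 1 1 e2 (etrans (congr1 _ i2) f2) (etrans (congr1 _ i2) r2).
have [dv4 _] := dvdg mu lam e4 (etrans (congr1 _ imu) f4) (etrans (congr1 _ imu) r4).
have D0 : den g != 0 := fiber_poly_neq0 None dg0.
have goo : P1app g None = None by rewrite P1app_comp i3.
have sD : (size (den g) + e3 = d.+1)%N.
  have := ramg None; rewrite i3 r3 /ram_index goo degg /=.
  have sD0 : (0 < size (den g))%N by rewrite size_poly_gt0.
  have aux (s : nat) : (0 < s -> (d - s.-1 = e3) -> s + e3 = d.+1)%N.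
    by move: h3; clear; lia.
  exact: aux.
have sN : size (num g) = d.+1.
  have := degree_eq g; rewrite degg => H; rewrite -H; apply/esym/maxn_idPl.
  rewrite leqNgt; apply/negP => lt; move: H; rewrite (maxn_idPr (ltnW lt)) => H.
  by move: sD; rewrite H -[RHS]addn0 => /addnI E; rewrite E in h3.
rewrite /fiber_poly scale0r (subr0 (num g)) in dv1 ndv1.
rewrite /fiber_poly scale1r in dv2.
split; [exact: Hi | | | split; [exact: sN | exact: sD | exact: D0 |]]; last first.
- by split; [exact: dv1 | exact: ndv1 | exact: dv2 | exact: dv4].
- apply/eqP => m1; apply: (ne4 y2 _ f2); last by rewrite Emu m1 -i2 ijK.
  by case=> E; move: l1; rewrite -E eqxx.
- apply/eqP => m0; apply: (ne4 y1 _ f1); last by rewrite Emu m0 -i1 ijK.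
  by case=> E; move: l0; rewrite -E eqxx.
Qed.

(** Every cover of the given type is isomorphic to one attached to a zero [mu] of
   [lam_poly]; in particular the numerical conditions hold. *)
Lemma cover_classification f lam d e1 e2 e3 : lam != 0 -> lam != 1 ->
    (1 < e1 < p)%N -> (1 < e2 < p)%N -> (1 < e3 < p)%N ->
    (e1 + e2 + e3 + p = d.*2 + 3)%N ->
    has_ramification_type lam d [tuple e1; e2; e3; p.-1] f ->
  exists m n, [/\ (p + m = d.+1)%N, (n + e3 = d.+1)%N, (n < p)%N &
    [/\ (e1 <= n)%N, (e2 <= n)%N &
      forall U P, exact_pade m n e1 e2 U P -> exists mu,
        [/\ mu != 0, mu != 1, lam != mu ^+ p, root (lam_poly p U P lam) mu
          & isomorphic (pencil_cover p U P lam mu) f]]].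
Proof.
move=> l0 l1 h1 h2 h3 sumE Hf.
have [i [mu [Hi m0 m1 [sN sD D0 [d1 nd1 d2 d4]]]]] :=
  normalize l0 l1 (ltnW (andP h3).1) Hf.
set g := P1comp f i in sN sD D0 d1 nd1 d2 d4.
have /andP[h1l h1p] := h1; have /andP[h2l h2p] := h2; have /andP[h3l h3p] := h3.
have nd1' : ~~ (('X - 0%:P) ^+ p %| num g).
  by apply: contra nd1; apply: dvdp_trans; rewrite dvdp_exp2l.
have [||||m [n [mE nE np [le1 [le2 [lmu [U1 [P1 [pUP1 sU1 ED EN]]]]]]]]] :=
  cover_pade char_k l0 l1 m0 m1 _ _ _ sumE (num_den_coprime g) D0 sN _ d1 nd1' d2 d4.
- by rewrite ltnW.
- exact: ltnW.
- by rewrite ltnW.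
- by rewrite sD.
exists m, n; split=> //; split=> // U P UP; exists mu.
have mnE : (m + n + 1 = e1 + e2)%N by move: mE nE sumE; clear; lia.
have [rmu [c c0 [cN cD]]] := cover_complete l0 l1 lmu mnE UP pUP1 sU1 ED EN.
split=> //; exists i => // y.
have podd : (2 < p)%N by apply: leq_ltn_trans h1l h1p.
rewrite -P1app_comp.
by apply: (P1app_scale c0); rewrite
  ?(cover_numE char_k l0 l1 m0 m1 UP) ?(cover_denE char_k l0 l1 m0 m1 UP).
Qed.

(** The isomorphism class of [f] among the covers of a given type. *)
Definition cover_class lam (d : nat) (e : 4.-tuple nat) f : set (P1map k) :=
  [set g | has_ramification_type lam d e g /\ isomorphic f g]%classic.

Lemma cover_class_eq lam d e f f' : isomorphic f f' ->
  cover_class lam d e f = cover_class lam d e f'.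
Proof.
move=> ff'; rewrite /cover_class; apply/seteqP; split=> g [Hg iso]; split=> //.
  exact: isomorphic_trans (isomorphic_sym ff') iso.
exact: isomorphic_trans ff' iso.
Qed.

Section Count.
Variables (m n e1 e2 e3 : nat) (U P : {poly k}) (lam : k).
Hypotheses (l0 : lam != 0) (l1 : lam != 1) (podd : (2 < p)%N).
Hypotheses (h1 : (1 < e1 < p)%N) (h2 : (1 < e2 < p)%N) (h3 : (1 < e3 < p)%N).
Hypotheses (mnE : (m + n + 1 = e1 + e2)%N) (hn : (n + e3 = p + m)%N).
Hypotheses (np : (n < p)%N) (UP : exact_pade m n e1 e2 U P).

Let lt_mn : (m < n)%N.
Proof. by move: hn h3; clear; lia. Qed.

Let sumE : (e1 + e2 + e3 + p = (p.-1 + m).*2 + 3)%N.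
Proof. by move: mnE hn podd; clear; lia. Qed.

Let dK : (p.-1 + m).+1 = (p + m)%N.
Proof. by rewrite -addSn (pred_charK char_k). Qed.

(* the cover attached to [mu], and the conditions on [mu] for it to be one *)
Notation C := (pencil_cover p U P lam).
Notation e := [tuple e1; e2; e3; p.-1].
Notation good mu := [/\ mu != 0, mu != 1, lam != mu ^+ p & root (lam_poly p U P lam) mu].

Lemma coverP f : has_ramification_type lam (p.-1 + m) e f ->
  exists2 mu, good mu & isomorphic (C mu) f.
Proof.
move=> Hf; have [m' [n' [mE nE _ [_ _ H]]]] :=
  cover_classification l0 l1 h1 h2 h3 sumE Hf.
have m'E : m' = m by move: mE; rewrite dK => /addnI.
have n'E : n' = n by move: nE; rewrite dK -hn => /addIn.
rewrite m'E n'E in H; have [mu [m0 m1 lmu rmu iso]] := H _ _ UP.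
by exists mu.
Qed.

(** Distinct parameters give non-isomorphic covers: an isomorphism fixes the
   points 0, 1 and infinity, being the only ramified points of their fibres. *)
Lemma cover_inj mu mu' : good mu -> good mu' -> isomorphic (C mu) (C mu') -> mu = mu'.
Proof.
move=> [m0 m1 lmu rmu] [m0' m1' lmu' rmu'] [i Hi iE].
have [[[d0 _ _] _ _ _] [r1 r2 r3 r4]] :=
  cover_ramification char_k l0 l1 m0 m1 UP lt_mn rmu lmu h1 h2 h3 podd hn.
have [[_ _ _ uni] [r1' r2' r3' r4']] :=
  cover_ramification char_k l0 l1 m0' m1' UP lt_mn rmu' lmu' h1 h2 h3 podd hn.
have transfer y x : ram_pt (C mu) y x -> ram_pt (C mu') (P1app i y) x.
  by case=> fy ry; split; rewrite /ramified ?iE // (@ram_index_iso _ (C mu) _ i y Hi iE d0).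
have uniq (j : 'I_4) y y' : ram_pt (C mu') y (tnth (branch_points lam) j) ->
    ram_pt (C mu') y' (tnth (branch_points lam) j) -> y = y'.
  by case: (uni j) => z [_ Hz] _ /Hz <- /Hz.
have i0 : P1app i (Some 0) = Some 0.
  by apply: (uniq (inord 0)); rewrite (tnth_nth None) inordK //; apply: transfer.
have i1 : P1app i (Some 1) = Some 1.
  by apply: (uniq (inord 1)); rewrite (tnth_nth None) inordK //; apply: transfer.
have i2 : P1app i None = None.
  by apply: (uniq (inord 2)); rewrite (tnth_nth None) inordK //; apply: transfer.
have : P1app i (Some mu) = Some mu'.
  by apply: (uniq (inord 3)); rewrite (tnth_nth None) inordK //; apply: transfer.
by rewrite P1iso_fix3 // => -[].
Qed.

Lemma card_cover_classes_le :
  (cover_classes lam (p.-1 + m) e #<= `I_(p - 1 - m))%card.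
Proof.
have [|||rs [_ srs rsE]] := lam_poly_roots char_k l0 l1 _ _ lt_mn mnE _ UP.
- by move: h1; clear; lia.
- by move: h2; clear; lia.
- by apply: ltn_trans np.
pose F t := cover_class lam (p.-1 + m) e (C (nth 0 rs t)).
apply: (@card_le_trans _ _ _ (F @` `I_(p - 1 - m))%classic); last exact: card_image_le.
apply: subset_card_le => _ [f Hf <-].
have [mu [m0 m1 lmu rmu] iso] := coverP Hf.
have mrs : mu \in rs by rewrite rsE m0 m1.
exists (index mu rs); first by rewrite /= -srs index_mem.
by rewrite /F nth_index //; apply: cover_class_eq.
Qed.

(** The bound is attained unless [lam] is the [p]-th power of a pole of
   [P / U]. *)
Lemma card_cover_classes : (forall mu, lam = mu ^+ p -> U.[mu] != 0) ->
  (cover_classes lam (p.-1 + m) e #= `I_(p - 1 - m))%card.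
Proof.
move=> Ugood.
have [|||rs [urs srs rsE]] := lam_poly_roots char_k l0 l1 _ _ lt_mn mnE _ UP.
- by move: h1; clear; lia.
- by move: h2; clear; lia.
- by apply: ltn_trans np.
have rsgood r : r \in rs -> good r.
  rewrite rsE => /and3P[r0 r1 rr]; split=> //; apply/eqP => lr.
  have := Ugood r lr; apply/negP; rewrite negbK.
  move: rr; rewrite rootE horner_lam_poly -lr subrr mul0r add0r !mulf_eq0 (negPf l0) orbF.
  by rewrite subr_eq0 eq_sym (negPf l1).
pose F t := cover_class lam (p.-1 + m) e (C (nth 0 rs t)).
have inrs t : (t < p - 1 - m)%N -> nth 0 rs t \in rs by rewrite -srs; apply: mem_nth.
have -> : cover_classes lam (p.-1 + m) e = (F @` `I_(p - 1 - m))%classic.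
  apply/seteqP; split=> [_ [f Hf <-]|_ [t /= lt <-]].
    have [mu [m0 m1 lmu rmu] iso] := coverP Hf.
    have mrs : mu \in rs by rewrite rsE m0 m1.
    exists (index mu rs); first by rewrite /= -srs index_mem.
    by rewrite /F nth_index //; apply: cover_class_eq.
  exists (C (nth 0 rs t)) => //; have [m0 m1 lmu rmu] := rsgood _ (inrs t lt).
  by have [] := cover_ramification char_k l0 l1 m0 m1 UP lt_mn rmu lmu h1 h2 h3 podd hn.
apply: inj_card_eq => s t; rewrite !inE /= => ls lt FE.
have [m0 m1 lmu rmu] := rsgood _ (inrs t lt).
have [Ht _] := cover_ramification char_k l0 l1 m0 m1 UP lt_mn rmu lmu h1 h2 h3 podd hn.
have : F s (C (nth 0 rs t)).
  by rewrite FE; split=> //; apply: isomorphic_refl.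
case=> _ /cover_inj E; apply/eqP; rewrite -(nth_uniq 0 _ _ urs) ?srs //; apply/eqP.
by apply: E; apply: rsgood; apply: inrs.
Qed.

End Count.
End Counting.
Lemma exp_char_inj (k : fieldType) (p : nat) (x y : k) :
  p \in [pchar k] -> x ^+ p = y ^+ p -> x = y.
Proof.
move=> ch; rewrite -!(pFrobenius_autE ch); exact: fmorph_inj.
Qed.

Theorem proposition3p2 (p : nat) (p_prime : prime p) (p_odd : odd p)
    (k : closedFieldType) (char_k : (p \in [pchar k])%R)
    (e1 e2 e3 : nat)
    (he1 : (1 < e1 < p)%N) (he2 : (1 < e2 < p)%N) (he3 : (1 < e3 < p)%N)
    (E_even : ~~ odd (e1 + e2 + e3)) (e3_neq : e3 <> (p - 1)%N) :
  let E := (e1 + e2 + e3)%N in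
  let d := ((E + p - 3)./2)%N in
  let cond := (p + 1 <= E <= p - 1 + 2 * minn e1 (minn e2 e3))%N in
  exists h : nat,
    [/\ is_pHurwitz0 k d [tuple e1; e2; e3; (p - 1)%N] h,
        (0 < h)%N <-> cond
      & cond -> h = ((3 * p - 1 - E)./2)%N].
Proof.
move=> E d cond; rewrite [X in [tuple _; _; _; X]]subn1.
have podd : (2 < p)%N by move: p_prime p_odd; case: (p) => [|[|[|]]].
have sumE : (e1 + e2 + e3 + p = d.*2 + 3)%N.
  by rewrite /d /E; move: E_even p_odd podd; clear; lia.
have sum_e : (\sum_(i < 4) (tnth [tuple e1; e2; e3; p.-1] i).-1 = d.*2 - 2)%N.
  rewrite !big_ord_recl big_ord0 /= !(tnth_nth 0%N) /=.
  by move: he1 he2 he3 sumE podd; clear; lia.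
case: (boolP cond) => [Hc|nHc].
  pose m := (d.+1 - p)%N; pose n := (d.+1 - e3)%N.
  have arith : [/\ (0 < e1 <= n)%N, (0 < e2 <= n)%N, (m + n + 1 = e1 + e2)%N,
      (n < p)%N & (n + e3 = p + m)%N /\ (d = p.-1 + m)%N].
    by rewrite /m /n; move: Hc sumE he1 he2 he3 podd; rewrite /cond /E; clear; split; lia.
  have [n1 n2 mnE np [hn dE]] := arith.
  have [U [P UP]] := exact_pade_exists char_k n1 n2 mnE np.
  have hE : ((3 * p - 1 - E)./2 = p - 1 - m)%N.
    by rewrite /m /E; move: Hc sumE he1 he2 he3 podd; rewrite /cond /E; clear; lia.
  exists (p - 1 - m)%N; split=> //; last first.
    split=> // _; rewrite /m; move: Hc sumE he1 he2 he3 podd; rewrite /cond /E; clear; lia.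
  split=> //; rewrite dE; last first.
    move=> lam l0 l1.
    exact: (card_cover_classes_le char_k l0 l1 podd he1 he2 he3 mnE hn np UP).
  have U0 : U != 0 by case: UP => _ sU _ _ _; rewrite -size_poly_gt0 sU.
  have [mu] : exists mu, (('X * ('X - 1%:P)) * U).[mu] != 0.
    by apply: exists_nonroot; rewrite !mulf_neq0 ?polyX_eq0 ?polyXsubC_eq0.
  rewrite !hornerM hornerX hornerXsubC !mulf_eq0 !negb_or subr_eq0.
  move=> /andP[/andP[m0 m1] Um].
  (* [mu] is the only [p]-th root of [lam = mu ^ p], and it is not a pole *)
  exists (mu ^+ p); split.
  - by rewrite expf_neq0.
  - apply: contra m1 => /eqP E1; apply/eqP; apply: (exp_char_inj char_k).
    by rewrite E1 expr1n.
  - apply: (card_cover_classes char_k) UP _ => //.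
    + by rewrite expf_neq0.
    + apply: contra m1 => /eqP E1; apply/eqP; apply: (exp_char_inj char_k).
      by rewrite E1 expr1n.
    + by move=> r /(exp_char_inj char_k) <-.
have cov0 lam : lam != 0 -> lam != 1 ->
    cover_classes lam d [tuple e1; e2; e3; p.-1] = set0%classic :> set (set (P1map k)).
  move=> l0 l1; apply/seteqP; split=> // S [f Hf _].
  have [m [n [mE nE np [n1 n2 _]]]] :=
    cover_classification char_k l0 l1 he1 he2 he3 sumE Hf.
  suff : cond by rewrite (negPf nHc).
  rewrite /cond /E.
  by move: mE nE np n1 n2 sumE; clear; lia.
exists 0%N; split=> //; split=> //; last first.
  by move=> lam l0 l1; rewrite cov0 // II0 card_lexx.
have [lam] : exists lam : k, ('X * ('X - 1%:P)).[lam] != 0.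
  by apply: exists_nonroot; rewrite !mulf_neq0 ?polyX_eq0 ?polyXsubC_eq0.
rewrite hornerM hornerX hornerXsubC mulf_eq0 negb_or subr_eq0 => /andP[l0 l1].
by exists lam; split=> //; rewrite cov0 // II0.
Qed.
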